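(* Let $\{Z_i\}_{i\ge0}$ be an AR(1) process with standard Gaussian innovations: $Z_i=a_1Z_{i-1}+\xi_i$ for $i\ge1$, where $\{\xi_i\}_{i\ge1}$ are i.i.d. with law $F=\mathcal{N}(0,1)$, independent of $Z_0\sim\mu$, and $a_1\in[0,1)$. (a) If the initial distribution is $\mu=\mathcal{N}:=\mathcal{N}(0,1/(1-a_1^2))$, then the exponent $\theta_F(a_1,\mathcal{N})$ defined by $$\log\theta_F(a_1,\mathcal{N}):=\lim_{n\to\infty}\frac1n\log\mathbb{P}\Big(\min_{0\le i\le n}Z_i\ge0\Big)$$ exists, belongs to $(0,1)$, and is continuous as a function of $a_1$. (b) If the initial distribution $\mu$ satisfies $$\limsup_{M\to\infty}\frac{1}{\log M}\log\mathbb{P}_\mu(Z_0>M)=0\quad\text{and}\quad\liminf_{M\to\infty}\frac1{\log M}\log\mathbb{P}_\mu(Z_0>M)=-\infty,$$ then there exist sequences $\{m_k\}_{k\ge1}$ and $\{n_k\}_{k\ge1}$ such that $$\lim_{k\to\infty}\frac1{m_k}\log\mathbb{P}\Big(\min_{0\le i\le m_k}Z_i\ge0\Big)=0,\qquad \lim_{k\to\infty}\frac1{n_k}\log\mathbb{P}\Big(\min_{0\le i\le n_k}Z_i\ge0\Big)=\log\theta_F(a_1,\mathcal{N}),$$ where $\theta_F(a_1,\mathcal{N})$ is as in part (a). In particular, the limit $\lim_{n\to\infty}\frac1n\log\mathbb{P}(\min_{0\le i\le n}Z_i\ge0)$ does not exist for any $a_1\in(0,1)$. (c) If $\mu=\delta_{x_0}$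 for some $x_0>0$, then the exponent $\theta_F(a_1,\delta_{x_0})$ defined by $$\log\theta_F(a_1,\delta_{x_0}):=\lim_{n\to\infty}\frac1n\log\mathbb{P}\Big(\min_{0\le i\le n}Z_i\ge0\Big)$$ exists, and equals $\theta_F(a_1,\mathcal{N})$ of part (a).
   Context: $\mathcal{N}(m,\sigma^2)$ denotes the Gaussian law with mean $m$ and variance $\sigma^2$; $\delta_{x_0}$ is the Dirac mass at $x_0$; $\mathbb{P}_\mu$ indicates that $Z_0$ has law $\mu$.
   Formalization: Part (b) is stated for a_1 in (0,1) instead of [0,1): for a_1 = 0 one has P(min Z_i ≥ 0) = P(Z_0 ≥ 0) 2^{-n}, so no sequence m_k can give limit 0 and the claim of (b) is false there. *)

(* Defs.v *)
From HB Require Import structures.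
From mathcomp Require Import all_boot all_order all_algebra finmap.
From mathcomp Require Import all_classical all_reals all_analysis.

Set Implicit Arguments.
Unset Strict Implicit.
Unset Printing Implicit Defensive.

Import Order.TTheory GRing.Theory Num.Theory.
Import numFieldNormedType.Exports.

Local Open Scope classical_set_scope.
Local Open Scope ring_scope.

(* Laws on the real line live on [measurableTypeR R], as in the library; its
   measurable sets are convertible to those of [R], the codomain of random
   variables. *)

(* [normal_prob] takes a standard deviation; [gaussian m v] is N(m, v) with
   variance [v].  For [v = 0] the library's [normal_prob] is a junk value, but
   only positive variances are used. *)
Definition gaussian (R : realType) (m v : R) : probability (measurableTypeR R) R :=
  normal_prob m (Num.sqrt v).

Definition dirac_law (R : realType) (x : R) : probability (measurableTypeR R) R :=
  dirac (x : measurableTypeR R).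

Definition has_law (R : realType) (d : measure_display) (T : measurableType d)
    (P : probability T R) (X : {RV P >-> R}) (mu : probability (measurableTypeR R) R) : Prop :=
  forall B : set R, measurable B -> distribution P X B = mu B.

Definition mutually_independent (R : realType) (d : measure_display)
    (T : measurableType d) (P : probability T R) (I : choiceType)
    (X : I -> {RV P >-> R}) : Prop :=
  forall (J : {fset I}) (B : I -> set R), (forall i, measurable (B i)) ->
    P (\bigcap_(i in [set` J]) (X i @^-1` B i)) =
    (\prod_(i <- J) P (X i @^-1` B i))%E.

(* The family (Z_0, xi_1, xi_2, ...): its mutual independence says that the
   innovations are independent and that Z_0 is independent of all of them. *)
Definition ar1_inputs (R : realType) (d : measure_display)
    (T : measurableType d) (P : probability T R)
    (Z xi : nat -> {RV P >-> R}) (i : nat) : {RV P >-> R} :=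
  if i is 0%N then Z 0%N else xi i.

(* The variable [xi 0] plays no role. *)
Record ar1_process (R : realType) (d : measure_display) (T : measurableType d)
    (P : probability T R) (a : R) (F mu : probability (measurableTypeR R) R)
    (Z xi : nat -> {RV P >-> R}) : Prop := Ar1Process {
  ar1_initial : has_law (Z 0%N) mu;
  ar1_innovation : forall i, (1 <= i)%N -> has_law (xi i) F;
  ar1_independent : mutually_independent (ar1_inputs Z xi);
  ar1_recursion : forall i, (1 <= i)%N ->
    forall w : T, Z i w = a * Z i.-1 w + xi i w
}.

Definition persistence_event (R : realType) (T : Type) (Z : nat -> T -> R)
    (n : nat) : set T :=
  [set w | 0 <= \big[Num.min/Z 0%N w]_(0 <= i < n.+1) Z i w].

(* Extended-real valued, with log 0 = -oo. *)
Definition persistence_rate (R : realType) (d : measure_display)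
    (T : measurableType d) (P : probability T R) (Z : nat -> {RV P >-> R})
    (n : nat) : \bar R :=
  ((n%:R^-1)%:E * lne (P (persistence_event (fun i => Z i : T -> R) n)))%E.

Definition log_tail_ratio (R : realType) (mu : probability (measurableTypeR R) R) (M : R) :
    \bar R :=
  (((ln M)^-1)%:E * lne (mu [set x | M < x]%R))%E.

(* log theta is the limit of the persistence rates of every AR(1) process with
   parameter [a], standard Gaussian innovations and initial law [mu], whatever
   the probability space carrying it. *)
Definition has_persistence_exponent (R : realType) (a : R)
    (mu : probability (measurableTypeR R) R) (theta : R) : Prop :=
  forall (d : measure_display) (T : measurableType d) (P : probability T R)
    (Z xi : nat -> {RV P >-> R}),
  ar1_process a (gaussian 0 1) mu Z xi ->
  persistence_rate Z n @[n --> \oo] --> lne theta%:E.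

(* Main.v *)
Require Import Defs.
From HB Require Import structures.
From mathcomp Require Import all_boot all_order all_algebra finmap.
From mathcomp Require Import all_classical all_reals all_analysis.
From mathcomp Require Import measurable_realfun.
From mathcomp Require Import ring lra.

(* Let [p_n x] be the probability that the chain started at [x] stays nonnegative for [n]
   steps; it is nondecreasing in [x].  By monotonicity [n |-> p_n 0] is supermultiplicative,
   so [log theta = sup_n (log (p_n 0)) / n] is a limit (Fekete).  All other statements compare
   [p_n x] with [p_n 0]:
   - climbing from [0] to [x] along [a^j x, ..., a x, x] costs a factor
     [exp (v_j x^2 / 2)] with [v_j = 1 - a^2 + a^(2 j)], so interpolating with [p_n <= 1],
     [p_n x <= C theta^((1 - t) n) exp (b x^2 / 2)] for some [b < 1 - a^2]; this is integrable
     against the stationary law, and gives (a) and (c);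
   - one step maps [exp (b x^2 / 2)] to a multiple of [exp (b' x^2 / 2)] with
     [b' = a^2 b / (1 - b)]; iterating, a start at height [a^-k] delays the decay of [p_n] by
     [O(k)] steps, whereas a start above [O(a^-n)] survives [n] steps with good probability;
     choosing [n] along the two sequences of levels provided by the tail hypotheses gives (b);
   - [exp (b x^2 / 2)] with [b] small is a Lyapunov function, hence [theta < 1];
   - Hoelder's inequality between the transition densities of parameters [a] and [a + d] bounds
     [theta (a + t d)] by [theta a ^ (1 - t) C ^ t]: [log theta] is locally Lipschitz. *)

Set Implicit Arguments.
Unset Strict Implicit.
Unset Printing Implicit Defensive.

Import Order.TTheory GRing.Theory Num.Theory.
Import numFieldNormedType.Exports.

Local Open Scope classical_set_scope.
Local Open Scope ring_scope.

(** * The Gaussian transition kernel *)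

Section translation.
Context {R : realType}.
Notation mu := (@lebesgue_measure R).

Let shift (c : R) : measurableTypeR R -> measurableTypeR R := fun z => z + c.

Let measurable_shift c : measurable_fun setT (shift c).
Proof. by move=> _; apply: measurable_funD. Qed.

HB.instance Definition _ c :=
  @isMeasurableFun.Build _ _ (measurableTypeR R) (measurableTypeR R) (shift c) (measurable_shift c).

(** The image of the measure under the shift gives half-open intervals their length, and this
    characterises Lebesgue measure. *)
Lemma lebesgue_measure_shift (c : R) (A : set R) : measurable A ->
  mu [set z | A (z + c)] = mu A.
Proof.
move=> mA; apply/esym.
apply: (@lebesgue_measure_unique _ (pushforward mu (shift c))) => // X [[a b] _ <-].
rewrite /pushforward /=.
have E : shift c @^-1` [set` `]a, b]] = [set` `]a - c, b - c]].
  by apply/seteqP; split=> z /=; rewrite !in_itv /= /shift; lra.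
transitivity (mu [set` `]a - c, b - c]]); last by congr (mu _).
by rewrite !lebesgue_measure_itv /= !lte_fin ltrD2r -!EFinB; case: ifP => // _; congr EFin; lra.
Qed.

Lemma ge0_integral_shift (c : R) (f : R -> \bar R) : measurable_fun [set: R] f ->
  (forall z, 0 <= f z)%E ->
  (\int[mu]_z f (z + c)%R = \int[mu]_z f z)%E.
Proof.
move=> mf f0; transitivity (\int[pushforward mu (shift c)]_z f z)%E.
  by rewrite ge0_integral_pushforward.
apply: eq_measure_integral => A mA _; exact: lebesgue_measure_shift.
Qed.
End translation.

(** * The transition operator killed at negative values, and its iterates *)

Section gaussian_kernel.
Context {R : realType}.
Notation mu := (@lebesgue_measure R).
Implicit Types a x y z : R.
Local Notation Rplus := ([set` `[0%R, +oo[] : set R).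

Definition phi (z : R) : R := normal_pdf 0 1 z.

Lemma phiE z : phi z = normal_peak 1 * expR (- (z ^+ 2 / 2)).
Proof. by rewrite /phi normal_pdfE ?oner_neq0 // /normal_fun subr0 expr1n mulNr. Qed.

Lemma phi_shift m z : phi (z - m) = normal_pdf m 1 z.
Proof. by rewrite /phi !normal_pdfE ?oner_neq0 // /normal_fun subr0. Qed.

Lemma normal_peak1_gt0 : 0 < normal_peak (1 : R).
Proof. by rewrite normal_peak_gt0 ?oner_neq0. Qed.

Lemma phi_gt0 z : 0 < phi z.
Proof. by rewrite phiE mulr_gt0 ?expR_gt0 ?normal_peak1_gt0. Qed.

Lemma phi_ge0 z : 0 <= phi z. Proof. exact/ltW/phi_gt0. Qed.

Lemma phi_le (y z : R) : `|y| <= `|z| -> phi z <= phi y.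
Proof.
move=> yz; rewrite !phiE ler_pM2l ?normal_peak1_gt0 // ler_expR lerN2.
by rewrite ler_pM2r ?invr_gt0 // -(real_normK (num_real y)) -(real_normK (num_real z)) lerXn2r ?nnegrE.
Qed.

Lemma measurable_phi_shift m : measurable_fun [set: R] (fun z => phi (z - m)).
Proof.
rewrite (_ : (fun z => _) = normal_pdf m 1); first exact: measurable_normal_pdf.
by apply/funext => z; rewrite phi_shift.
Qed.

Lemma integral_phi_shift m : (\int[mu]_z (phi (z - m))%:E = 1)%E.
Proof.
under eq_integral do rewrite phi_shift.
exact: integral_normal_pdf.
Qed.

(** Transition operator of the chain killed on entering the negative half-line. *)
Definition kernel_op (a : R) (h : R -> R) (x : R) : \bar R :=
  (\int[mu]_(z in Rplus) (phi (z - a * x) * h z)%:E)%E.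

Lemma kernel_op_ge0 a h x : (forall z, 0 <= z -> 0 <= h z) -> (0 <= kernel_op a h x)%E.
Proof.
move=> h0; apply: integral_ge0 => z /=; rewrite in_itv /= andbT => z0.
by rewrite lee_fin mulr_ge0 ?phi_ge0 ?h0.
Qed.

Lemma measurable_kernel_integrand a x (h : R -> R) (D : set R) : measurable_fun [set: R] h ->
  measurable_fun D (fun z => (phi (z - a * x) * h z)%:E).
Proof.
move=> mh; apply: (measurable_funS measurableT) => //; apply/measurable_EFinP.
by apply: measurable_funM => //; exact: measurable_phi_shift.
Qed.

Lemma kernel_op_le a (g h : R -> R) x : measurable_fun [set: R] g -> measurable_fun [set: R] h ->
  (forall z, 0 <= z -> 0 <= g z <= h z) -> (kernel_op a g x <= kernel_op a h x)%E.
Proof.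
move=> mg mh gh; apply: ge0_le_integral => //=.
- by move=> z; rewrite in_itv /= andbT => z0; rewrite lee_fin mulr_ge0 ?phi_ge0 //; case/andP: (gh _ z0).
- exact: measurable_kernel_integrand.
- exact: measurable_kernel_integrand.
- move=> z; rewrite in_itv /= andbT => z0; rewrite lee_fin ler_wpM2l ?phi_ge0 //.
  by case/andP: (gh _ z0).
Qed.

Lemma kernel_opZ a (c : R) (h : R -> R) x : measurable_fun [set: R] h -> (forall z, 0 <= z -> 0 <= h z) -> 0 <= c ->
  (kernel_op a (fun z => c * h z)%R x = c%:E * kernel_op a h x)%E.
Proof.
move=> mh h0 c0; rewrite /kernel_op -ge0_integralZl_EFin //=.
- by apply: eq_integral => z _; rewrite -EFinM; congr EFin; ring.
- by move=> z; rewrite in_itv /= andbT => z0; rewrite lee_fin mulr_ge0 ?phi_ge0 ?h0.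
- exact: measurable_kernel_integrand.
Qed.

Lemma kernel_op1_le1 a x : (kernel_op a (cst 1%R) x <= 1)%E.
Proof.
rewrite -(integral_phi_shift (a * x)) /kernel_op.
under eq_integral do rewrite mulr1.
apply: ge0_subset_integral => //=.
- by apply/measurable_EFinP; exact: measurable_phi_shift.
- by move=> z _; rewrite lee_fin phi_ge0.
Qed.

(* Recentring at [a x] makes the dependence on [x] monotone. *)
Lemma kernel_op_shift a (h : R -> R) x : measurable_fun [set: R] h -> (forall z, 0 <= z -> 0 <= h z) ->
  (kernel_op a h x =
   \int[mu]_y ((phi y * (if 0 <= a * x + y then h (a * x + y) else 0))%:E)%R)%E.
Proof.
move=> mh h0.
rewrite /kernel_op integral_mkcond.
rewrite -[LHS](ge0_integral_shift (a * x)).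
- apply: eq_integral => y _; rewrite /patch mem_setE in_itv /= andbT addrC.
  by case: ifP => //; rewrite ?mulr0 // addrAC subrr add0r.
- by apply/(measurable_restrictT _ _).1 => //; exact: measurable_kernel_integrand.
- move=> z; rewrite /patch mem_setE in_itv /= andbT; case: ifP => // z0.
  by rewrite lee_fin mulr_ge0 ?phi_ge0 ?h0.
Qed.

(** A coupling: the same noise [y] carries the larger start to the larger position, and being
    killed, which counts as 0, is never better than surviving. *)
Lemma kernel_op_nd a (h : R -> R) : 0 <= a -> measurable_fun [set: R] h -> (forall z, 0 <= z -> 0 <= h z) ->
  {homo h : x y / x <= y} -> {homo kernel_op a h : x y / x <= y >-> (x <= y)%E}.
Proof.
move=> a0 mh h0 hh x y xy; rewrite !kernel_op_shift //.
have H u : (0 <= (if 0 <= u then h u else 0))%R by case: ifP => // /h0.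
have M w : measurable_fun [set: R]
  (fun y0 => (phi y0 * (if 0 <= w + y0 then h (w + y0) else 0)%R)%:E).
  apply/measurable_EFinP; apply: measurable_funM; first by exact: measurable_normal_pdf.
  apply: measurable_fun_if => //=.
  - apply: measurable_fun_ler => //; exact: measurable_funD.
  - apply: measurable_funTS; apply: measurableT_comp => //; exact: measurable_funD.
apply: ge0_le_integral => //=.
- by move=> z _; rewrite lee_fin mulr_ge0 ?phi_ge0.
- exact: M.
- exact: M.
- move=> z _; rewrite lee_fin ler_wpM2l ?phi_ge0 //.
  have l : a * x + z <= a * y + z by rewrite lerD2r ler_wpM2l.
  case: (leP 0 (a * x + z)) => h1; last exact: H.
  by rewrite (le_trans h1 l) hh.
Qed.


(** Probability that the [n] positions following the start [x] are nonnegative; the sign of [x]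
    itself is not tested. For [0 <= a], [fine] loses nothing, since the operator then takes values
    in [0, 1]. *)
Fixpoint persist (a : R) (n : nat) : R -> R :=
  if n is m.+1 then fun x => fine (kernel_op a (persist a m) x) else cst 1.

Lemma persist_props a n : 0 <= a ->
  [/\ measurable_fun [set: R] (persist a n), forall x, 0 <= persist a n x <= 1
    & {homo persist a n : x y / x <= y}].
Proof.
move=> a0; elim: n => [|n [mp p01 ph]] /=.
  by split=> // x; rewrite ler01 lexx.
have p0 z : 0 <= z -> 0 <= persist a n z by case/andP: (p01 z).
have K0 x : (0 <= kernel_op a (persist a n) x)%E by exact: kernel_op_ge0.
have K1 x : (kernel_op a (persist a n) x <= 1)%E.
  apply: le_trans (kernel_op1_le1 a x).
  by apply: kernel_op_le => // z _; exact: p01.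
have Kfin x : kernel_op a (persist a n) x \is a fin_num.
  by rewrite ge0_fin_numE // (le_lt_trans (K1 x)) // ltry.
have hn : {homo (fun x => fine (kernel_op a (persist a n) x)) : x y / x <= y}.
  move=> x y xy; apply: fine_le => //; exact: (kernel_op_nd a0 mp p0 ph xy).
split=> //; first by apply: nondecreasing_measurable.
by move=> x; rewrite -!lee_fin fineK // K0 K1.
Qed.

Lemma measurable_persist a n : 0 <= a -> measurable_fun [set: R] (persist a n).
Proof. by move=> a0; case: (persist_props n a0). Qed.

Lemma persist_ge0 a n x : 0 <= a -> 0 <= persist a n x.
Proof. by move=> a0; case: (persist_props n a0) => _ /(_ x)/andP[]. Qed.

Lemma persist_le1 a n x : 0 <= a -> persist a n x <= 1.
Proof. by move=> a0; case: (persist_props n a0) => _ /(_ x)/andP[]. Qed.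

Lemma persist_nd a n x y : 0 <= a -> x <= y -> persist a n x <= persist a n y.
Proof. by move=> a0 xy; case: (persist_props n a0) => _ _; exact. Qed.

Lemma persistS a n x : 0 <= a ->
  ((persist a n.+1 x)%:E = kernel_op a (persist a n) x)%E.
Proof.
move=> a0 /=; rewrite fineK // ge0_fin_numE; last first.
  by apply: kernel_op_ge0 => z _; exact: persist_ge0.
apply: le_lt_trans (ltry 1); apply: le_trans (kernel_op1_le1 a x).
apply: kernel_op_le => //; first exact: measurable_persist.
by move=> z _; rewrite persist_ge0 ?persist_le1.
Qed.

(* Only the transitions into [[x, x + 1]] are kept. *)
Lemma persistS_ge a n x y : 0 <= a -> 0 <= x -> 2 * (a * y) <= 2 * x + 1 ->
  phi (x + 1 - a * y) * persist a n x <= persist a n.+1 y.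
Proof.
move=> a0 x0 yx; rewrite -lee_fin persistS //.
have -> : ((phi (x + 1 - a * y) * persist a n x)%:E =
  \int[mu]_(z in [set` `[x, (x + 1)%R]]) (phi (x + 1 - a * y) * persist a n x)%:E)%E.
  rewrite integral_cst //= lebesgue_measure_itv /= lte_fin ltrDl ltr01 -EFinD.
  by rewrite [(x + 1)%R]addrC addrK mule1.
apply: (@le_trans _ _ (\int[mu]_(z in [set` `[x, (x + 1)%R]])
    (phi (z - a * y) * persist a n z)%:E)%E); last first.
  apply: ge0_subset_integral => //=.
  - by apply: measurable_kernel_integrand; exact: measurable_persist.
  - by move=> z _; rewrite lee_fin mulr_ge0 ?phi_ge0 ?persist_ge0.
  - by move=> z /=; rewrite !in_itv /= andbT => /andP[? _]; exact: le_trans x0 _.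
apply: ge0_le_integral => //=.
- by move=> z _; rewrite lee_fin mulr_ge0 ?phi_ge0 ?persist_ge0.
- by apply: measurable_kernel_integrand; exact: measurable_persist.
- move=> z; rewrite in_itv /= => /andP[xz zx]; rewrite lee_fin ler_pM ?phi_ge0 ?persist_ge0 //.
    (* The hypothesis puts [a * y] at or left of the midpoint of [[x, x + 1]], so the right endpoint
       is the farthest from it. *)
    by apply: phi_le; rewrite (ger0_norm (_ : 0 <= x + 1 - a * y)) ?ler_norml; lra.
  exact: persist_nd.
Qed.

Lemma persist_gt0 a n x : 0 <= a -> 0 <= x -> 0 < persist a n x.
Proof.
move=> a0 x0; suff : 0 < persist a n 0 by move/lt_le_trans; apply; exact: persist_nd.
elim: n => [|n IH]; first exact: ltr01.
apply: lt_le_trans (persistS_ge (x := 0) (y := 0) n a0 _ _); rewrite ?mulr0 ?add0r //.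
by rewrite mulr_gt0 ?phi_gt0.
Qed.

(** At each step keep only the landings in [[0, 1]], then bring the chain back to 0 by monotonicity.
    This bounds the rates from below, uniformly in [a]. *)
Lemma persist0_ge a n : 0 <= a -> phi 1 ^+ n <= persist a n 0.
Proof.
move=> a0; elim: n => [|n IH]; first by rewrite expr0.
apply: le_trans (persistS_ge (x := 0) (y := 0) n a0 _ _); rewrite ?mulr0 ?add0r ?subr0 //.
by rewrite exprS ler_wpM2l ?phi_ge0.
Qed.

(** Markov property at time [n]: the surviving chain is then at a nonnegative point, from which it
    does at least as well as from 0. *)
Lemma persist_super a n m x : 0 <= a -> 0 <= x ->
  persist a n x * persist a m 0 <= persist a (n + m)%N x.
Proof.
move=> a0; elim: n x => [|n IH] x x0; first by rewrite mul1r persist_nd.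
rewrite addSn -lee_fin EFinM !persistS // muleC -kernel_opZ //.
- apply: kernel_op_le => //.
  + by apply: measurable_funM => //; exact: measurable_persist.
  + exact: measurable_persist.
  + by move=> z z0; rewrite mulr_ge0 ?persist_ge0 //= mulrC IH.
- exact: measurable_persist.
- by move=> z _; exact: persist_ge0.
- exact: persist_ge0.
Qed.

End gaussian_kernel.

(** * The exponent and estimates on the persistence probabilities *)

Section growth_exponent.
Context {R : realType}.
Implicit Types a x y z : R.

(** The supremum of Fekete's lemma; times start at 1, so there is no division by zero. *)
Definition log_theta a : R :=
  sup [set ln (persist a n.+1 0) / n.+1%:R | n in [set: nat]].

Lemma ln_phi1_le0 : ln (phi 1) <= 0 :> R.
Proof.
apply: ln_le0; have := persist0_ge (a := 0) 1 (lexx (0 : R)); rewrite expr1 => /le_trans; apply.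
exact: persist_le1.
Qed.

Lemma expR_lnX (u : R) (n : nat) : 0 < u -> u ^+ n = expR (n%:R * ln u).
Proof. by move=> u0; rewrite expRM_natl lnK. Qed.

Let rates_bounds a n : 0 <= a -> ln (phi 1) <= ln (persist a n.+1 0) / n.+1%:R <= 0.
Proof.
move=> a0; have p0 := persist_gt0 n.+1 a0 (lexx 0).
rewrite ler_pdivlMr // ler_pdivrMr // mul0r ln_le0 ?persist_le1 // andbT.
rewrite -ler_expR lnK // mulrC -expR_lnX ?phi_gt0 //; exact: persist0_ge.
Qed.

Let has_sup_rates a : 0 <= a ->
  has_sup [set ln (persist a n.+1 0) / n.+1%:R | n in [set: nat]].
Proof.
move=> a0; split; first by exists (ln (persist a 1 0) / 1%:R); exists 0%N.
by exists 0 => _ [n _ <-]; case/andP: (rates_bounds n a0).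
Qed.

Lemma log_theta_ge a : 0 <= a -> ln (phi 1) <= log_theta a.
Proof.
move=> a0; case/andP: (rates_bounds 0 a0) => h _; apply: le_trans h _.
by apply: ub_le_sup; [exact: (has_sup_rates a0).2|exists 0%N].
Qed.

Lemma log_theta_le0 a : 0 <= a -> log_theta a <= 0.
Proof.
move=> a0; apply: ge_sup; first exact: (has_sup_rates a0).1.
by move=> _ [n _ <-]; case/andP: (rates_bounds n a0).
Qed.

Lemma persist0_le a n : 0 <= a -> persist a n 0 <= expR (n%:R * log_theta a).
Proof.
move=> a0; case: n => [|n]; first by rewrite mul0r expR0.
rewrite -[leLHS]lnK ?posrE ?persist_gt0 // ler_expR mulrC -ler_pdivrMr //.
by apply: ub_le_sup; [exact: (has_sup_rates a0).2|exists n].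
Qed.

Lemma persist0_mul a k q : 0 <= a -> persist a k 0 ^+ q <= persist a (q * k) 0.
Proof.
move=> a0; elim: q => [|q IH]; first by rewrite expr0 mul0n.
rewrite mulSn exprS; apply: le_trans (persist_super k (q * k) a0 (lexx 0)).
by rewrite ler_wpM2l ?persist_ge0.
Qed.

(* Fekete's argument for the supermultiplicative sequence [persist a n 0]. *)
Lemma persist0_lower a e : 0 <= a -> 0 < e ->
  exists2 C : R, 0 < C & forall n, C * expR (n%:R * (log_theta a - e)) <= persist a n 0.
Proof.
move=> a0 e0.
have [_ [k _ <-] hk] := sup_adherent e0 (has_sup_rates a0).
exists (phi 1 ^+ k.+1); first by rewrite exprn_gt0 // phi_gt0.
move=> n; set l := log_theta a - e.
have l0 : l <= 0 by rewrite subr_le0 (le_trans (log_theta_le0 a0)) // ltW.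
have h1 : expR (k.+1%:R * l) <= persist a k.+1 0.
  rewrite -[leRHS]lnK ?posrE ?persist_gt0 // ler_expR mulrC -ler_pdivlMr //.
  exact: ltW.
have phi1 : phi 1 <= 1 :> R.
  by rewrite -[leLHS]lnK ?posrE ?phi_gt0 // expR_le1 ln_phi1_le0.
(* Full blocks of length [k.+1] are bounded through [persist0_mul], the remainder through
   [persist0_ge], at a price paid once by the constant. Since [l <= 0], the length of the blocks may
   be replaced by [n] in the exponent. *)
rewrite [in leRHS](divn_eq n k.+1).
apply: le_trans (persist_super _ _ a0 (lexx 0)).
rewrite mulrC; apply: ler_pM.
- exact: expR_ge0.
- by rewrite exprn_ge0 // phi_ge0.
- apply: le_trans (persist0_mul _ _ a0).
  apply: (@le_trans _ _ (expR (k.+1%:R * l) ^+ (n %/ k.+1))); last first.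
    by rewrite lerXn2r // nnegrE ?expR_ge0 ?persist_ge0.
  rewrite -expRM_natl ler_expR mulrA ler_wnM2r // -natrM ler_nat.
  exact: leq_trunc_div.
- apply: le_trans (persist0_ge _ a0).
  rewrite ler_wiXn2l ?phi_ge0 //; exact/ltnW/ltn_pmod.
Qed.

End growth_exponent.

(** * Gaussian integrals and an interpolation inequality *)

Section gaussian_estimates.
Context {R : realType}.
Notation mu := (@lebesgue_measure R).
Local Notation Rplus := ([set` `[0%R, +oo[] : set R).
Implicit Types a x y z : R.

(** Up to the constant on the right, the integrand is the normal density of mean [m] and variance
    [k^-1]. *)
Lemma gauss_integral (k m : R) : 0 < k ->
  (\int[mu]_z (normal_peak 1 * expR (- (k * (z - m) ^+ 2 / 2)))%:E =
   (Num.sqrt k^-1)%:E)%E.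
Proof.
move=> k0; set s := Num.sqrt k^-1.
have s0 : 0 < s by rewrite sqrtr_gt0 invr_gt0.
have s2 : s ^+ 2 = k^-1 by rewrite sqr_sqrtr // invr_ge0 ltW.
rewrite -[RHS]mule1 -(integral_normal_pdf m s) -ge0_integralZl_EFin //=.
- have E1 : normal_peak 1 = s * normal_peak s.
    rewrite /normal_peak expr1n mul1r -mulrnAr sqrtrM ?sqr_ge0 // sqrtr_sqr ger0_norm ?ltW //.
    by rewrite invfM mulrA divff ?mul1r // gt_eqF.
  have E2 z : - (k * (z - m) ^+ 2 / 2) = - (z - m) ^+ 2 / (s ^+ 2 *+ 2).
    rewrite s2; field; exact: lt0r_neq0.
  apply: eq_integral => z _; rewrite -EFinM normal_pdfE ?gt_eqF // /normal_fun.
  by rewrite E1 E2 mulrA.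
- by move=> z _; rewrite lee_fin normal_pdf_ge0.
- by apply/measurable_EFinP; exact: measurable_normal_pdf.
- exact: ltW.
Qed.

Lemma measurable_expR_sqr (c : R) : measurable_fun [set: R] (fun z : R => expR (c * z ^+ 2 / 2)).
Proof.
apply: measurableT_comp => //; apply: measurable_funM => //; exact: measurable_funM.
Qed.

Lemma measurable_gauss (c k m : R) :
  measurable_fun [set: R] (fun z => (c * expR (- (k * (z - m) ^+ 2 / 2)))%:E).
Proof.
apply/measurable_EFinP; apply: measurable_funM => //; apply: measurableT_comp => //.
apply: measurableT_comp => //; apply: measurable_funM => //; apply: measurable_funM => //.
by apply: measurable_funX; exact: measurable_funB.
Qed.

(** Complete the square: the integrand is a multiple of a Gaussian centred at [a * x / (1 - b)] with
    variance [(1 - b)^-1]. Enlarging the half-line to the whole line gives the bound. *)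
Lemma kernel_op_expR_sqr a x (b : R) : b < 1 ->
  (kernel_op a (fun z => expR (b * z ^+ 2 / 2))%R x <=
   (Num.sqrt (1 - b)^-1 * expR (a ^+ 2 * b / (1 - b) * x ^+ 2 / 2))%:E)%E.
Proof.
move=> b1; have k0 : 0 < 1 - b by rewrite subr_gt0.
set m := a * x / (1 - b); set c := expR (a ^+ 2 * b / (1 - b) * x ^+ 2 / 2).
rewrite mulrC EFinM -(gauss_integral m k0) -ge0_integralZl_EFin //=; last 3 first.
- by move=> z _; rewrite lee_fin mulr_ge0 ?expR_ge0 // ltW // normal_peak1_gt0.
- exact: measurable_gauss.
- exact: expR_ge0.
have E z : (phi (z - a * x) * expR (b * z ^+ 2 / 2))%:E =
  (c%:E * (normal_peak 1 * expR (- ((1 - b) * (z - m) ^+ 2 / 2)))%:E)%E.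
  rewrite -EFinM phiE; congr EFin; rewrite [RHS]mulrCA -!mulrA; congr (_ * _).
  rewrite /c -!expRD; congr expR; rewrite /m; field; exact: lt0r_neq0.
rewrite /kernel_op; under eq_integral do rewrite E.
apply: ge0_subset_integral => //=.
- by apply: measurable_funeM; exact: measurable_gauss.
- by move=> z _; rewrite mule_ge0 // lee_fin ?expR_ge0 // mulr_ge0 ?expR_ge0 // ltW // normal_peak1_gt0.
Qed.

(** Both exponentials lie above the tangent at the convex combination [m], and the linear terms
    cancel on averaging. *)
Lemma expR_convex (t p q : R) : 0 <= t <= 1 ->
  expR ((1 - t) * p + t * q) <= (1 - t) * expR p + t * expR q.
Proof.
move=> /andP[t0 t1]; set m := (1 - t) * p + t * q.
have H r : expR m * (1 + (r - m)) <= expR r.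
  have -> : expR r = expR m * expR (r - m) by rewrite -expRD addrC subrK.
  by rewrite ler_wpM2l ?expR_ge0 ?expR_ge1Dx.
have := ler_wpM2l t0 (H q); have := ler_wpM2l (_ : 0 <= 1 - t) (H p).
rewrite subr_ge0 t1 => /(_ isT) h1 h2; apply: le_trans (lerD h1 h2).
move: (expR m) => M; rewrite le_eqVlt; apply/orP; left; apply/eqP; rewrite /m; ring.
Qed.

(** Hoelder's inequality in logarithmic form: normalise [f] by [F] and [g] by [G], then integrate
    the pointwise weighted arithmetic-geometric inequality. Upper bounds [F] and [G] on the two
    integrals are enough. *)
Lemma log_hoelder (D : set R) (f g h : R -> R) (F G t : R) : measurable D ->
  measurable_fun [set: R] f -> measurable_fun [set: R] g -> measurable_fun [set: R] h ->
  0 <= t <= 1 -> 0 < F -> 0 < G ->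
  (forall z, D z -> 0 < f z) -> (forall z, D z -> 0 < g z) ->
  (forall z, D z -> 0 <= h z <= expR ((1 - t) * ln (f z) + t * ln (g z))) ->
  (\int[mu]_(z in D) (f z)%:E <= F%:E)%E -> (\int[mu]_(z in D) (g z)%:E <= G%:E)%E ->
  (\int[mu]_(z in D) (h z)%:E <= (expR ((1 - t) * ln F + t * ln G))%:E)%E.
Proof.
move=> mD mf mg mh t01 F0 G0 f0 g0 hfg fF gG; have /andP[t0 t1] := t01.
set E := expR _; pose c1 := E * (1 - t) / F; pose c2 := E * t / G.
have c10 : 0 <= c1 by rewrite /c1 !mulr_ge0 ?expR_ge0 ?subr_ge0 // invr_ge0 ltW.
have c20 : 0 <= c2 by rewrite /c2 !mulr_ge0 ?expR_ge0 // invr_ge0 ltW.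
have mD' (u : R -> R) : measurable_fun [set: R] u -> measurable_fun D (fun z => (u z)%:E).
  by move=> mu'; apply/measurable_EFinP; exact: measurable_funTS.
apply: (@le_trans _ _ (\int[mu]_(z in D) (c1%:E * (f z)%:E + c2%:E * (g z)%:E))%E).
  apply: ge0_le_integral => //.
  - by move=> z Dz; rewrite lee_fin; case/andP: (hfg z Dz).
  - exact: mD'.
  - by apply: emeasurable_funD; apply: measurable_funeM; exact: mD'.
  - move=> z Dz; rewrite -!EFinM -EFinD lee_fin.
    case/andP: (hfg z Dz) => _ /le_trans; apply.
    have := expR_convex (ln (f z) - ln F) (ln (g z) - ln G) t01.
    rewrite !expRB !lnK ?posrE ?f0 ?g0 // => H.
    have -> : expR ((1 - t) * ln (f z) + t * ln (g z)) =
        E * expR ((1 - t) * (ln (f z) - ln F) + t * (ln (g z) - ln G)).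
      by rewrite /E -expRD; congr expR; ring.
    have E0 : 0 <= E by exact: expR_ge0.
    apply: le_trans (ler_wpM2l E0 H) _.
    by rewrite /c1 /c2 le_eqVlt; apply/orP; left; apply/eqP; ring.
rewrite ge0_integralD //; last 4 first.
- by move=> z Dz; rewrite -EFinM lee_fin mulr_ge0 // ltW // f0.
- by apply: measurable_funeM; exact: mD'.
- by move=> z Dz; rewrite -EFinM lee_fin mulr_ge0 // ltW // g0.
- by apply: measurable_funeM; exact: mD'.
rewrite !ge0_integralZl_EFin //; last 4 first.
- by move=> z Dz; rewrite lee_fin ltW // g0.
- exact: mD'.
- by move=> z Dz; rewrite lee_fin ltW // f0.
- exact: mD'.
have -> : E%:E = (c1%:E * F%:E + c2%:E * G%:E)%E.
  rewrite -!EFinM -EFinD; congr EFin; rewrite /c1 /c2; field.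
  by rewrite !gt_eqF.
by apply: leeD; apply: lee_wpmul2l.
Qed.

End gaussian_estimates.

(** * Descending from a height, climbing to it, and the upper bound on survival *)

Section persistence_estimates.
Context {R : realType}.
Notation mu := (@lebesgue_measure R).
Local Notation Rplus := ([set` `[0%R, +oo[] : set R).
Implicit Types a x y z : R.

Lemma exists_exp_lt a (e : R) : 0 <= a < 1 -> 0 < e -> exists n : nat, a ^+ n < e.
Proof.
move=> /andP[a0 a1] e0.
have : (a ^+ n @[n --> \oo] --> (0 : R)).
  by apply: cvg_expr; rewrite ger0_norm.
move/cvgr_lt => /(_ e e0)[N _ /(_ N (leqnn N))] ?; by exists N.
Qed.

(* Chernoff bound: for [z < m - r], [phi (z - m) <= expR (1/2 - r) * phi (z - (m - 1))]. *)
Lemma gauss_upper_tail (m r : R) :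
  (1 <= \int[mu]_(z in [set` `[(m - r)%R, +oo[]) (phi (z - m))%:E + (expR (1 / 2 - r))%:E)%E.
Proof.
set c := expR _.
have c0 : 0 <= c by exact: expR_ge0.
have mphi u : measurable_fun [set: R] (fun z => (phi (z - u))%:E).
  by apply/measurable_EFinP; exact: measurable_phi_shift.
pose g (z : R) := if m - r <= z then phi (z - m) else 0.
have mg : measurable_fun [set: R] (fun z => (g z)%:E).
  apply/measurable_EFinP; apply: measurable_fun_if => //=.
  - exact: measurable_fun_ler.
  - apply: measurable_funTS; exact: measurable_phi_shift.
have g0 z : 0 <= g z by rewrite /g; case: ifP => // _; exact: phi_ge0.
have -> : (\int[mu]_(z in [set` `[(m - r)%R, +oo[]) (phi (z - m))%:E = \int[mu]_z (g z)%:E)%E.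
  rewrite integral_mkcond; apply: eq_integral => z _.
  by rewrite /patch mem_setE in_itv /= andbT /g; case: ifP.
have -> : c%:E = (\int[mu]_z (c%:E * (phi (z - (m - 1)))%:E))%E.
  rewrite ge0_integralZl_EFin //= ?integral_phi_shift ?mule1 //.
  - by move=> z _; rewrite lee_fin phi_ge0.
  - exact: mphi.
rewrite -(integral_phi_shift m) -ge0_integralD //=; last 3 first.
- by move=> z _; rewrite lee_fin g0.
- by move=> z _; rewrite -EFinM lee_fin mulr_ge0 ?phi_ge0.
- by apply: measurable_funeM; exact: mphi.
apply: ge0_le_integral => //=.
- by move=> z _; rewrite lee_fin phi_ge0.
- exact: mphi.
- by apply: emeasurable_funD => //; apply: measurable_funeM; exact: mphi.
- move=> z _; rewrite -EFinM -EFinD lee_fin /g; case: (leP (m - r) z) => mz.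
    by rewrite lerDl mulr_ge0 ?phi_ge0.
  rewrite add0r !phiE mulrCA ler_pM2l ?normal_peak1_gt0 // -expRD ler_expR.
  have -> : - ((z - (m - 1)) ^+ 2 / 2) = - ((z - m) ^+ 2 / 2) - (z - m) - 1 / 2 by field.
  lra.
Qed.

(** By [gauss_upper_tail] the noise is at least [- r] with probability at least
    [1 - expR (1 / 2 - r)]; the chain then lands at or above [a * x - r]. *)
Lemma persistS_descent a n x (r : R) : 0 <= a -> 0 <= a * x - r ->
  (1 - expR (1 / 2 - r)) * persist a n (a * x - r) <= persist a n.+1 x.
Proof.
move=> a0 xr; set y := a * x - r; set p := persist a n y.
have p0 : 0 <= p by exact: persist_ge0.
set D := [set` `[y, +oo[] : set R.
have mD : measurable D by exact: measurable_itv.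
apply: (@le_trans _ _ (fine (p%:E * \int[mu]_(z in D) (phi (z - a * x))%:E)%E)).
  have I1 : (\int[mu]_(z in D) (phi (z - a * x))%:E <= 1)%E.
    rewrite -(integral_phi_shift (a * x)); apply: ge0_subset_integral => //=.
    - by apply/measurable_EFinP; exact: measurable_phi_shift.
    - by move=> z _; rewrite lee_fin phi_ge0.
  have I0 : (0 <= \int[mu]_(z in D) (phi (z - a * x))%:E)%E.
    by apply: integral_ge0 => z _; rewrite lee_fin phi_ge0.
  have := gauss_upper_tail (a * x) r; rewrite -/y -/D.
  move: I0 I1; case: (\int[mu]_(z in D) _)%E => [i| |] //.
  rewrite -EFinD !lee_fin => i0 i1 h /=; rewrite mulrC ler_wpM2l //; lra.
rewrite -lee_fin persistS // fineK; last first.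
  rewrite ge0_fin_numE; last first.
    by rewrite mule_ge0 ?lee_fin // integral_ge0 // => z _; rewrite lee_fin phi_ge0.
  apply: (@le_lt_trans _ _ (p%:E * 1)%E); last by rewrite mule1 ltry.
  apply: lee_wpmul2l; rewrite ?lee_fin // -(integral_phi_shift (a * x)).
  apply: ge0_subset_integral => //=.
  - by apply/measurable_EFinP; exact: measurable_phi_shift.
  - by move=> z _; rewrite lee_fin phi_ge0.
rewrite -ge0_integralZl_EFin //=; last 2 first.
- by move=> z _; rewrite lee_fin phi_ge0.
- by apply/measurable_EFinP; apply: measurable_funTS; exact: measurable_phi_shift.
apply: (@le_trans _ _ (\int[mu]_(z in D) (phi (z - a * x) * persist a n z)%:E)%E).
  apply: ge0_le_integral => //=.
  - by move=> z _; rewrite -EFinM lee_fin mulr_ge0 ?phi_ge0.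
  - apply: measurable_funeM; apply/measurable_EFinP; apply: measurable_funTS.
    exact: measurable_phi_shift.
  - apply: measurable_kernel_integrand; exact: measurable_persist.
  - move=> z; rewrite /D /= in_itv /= andbT => yz.
    by rewrite -EFinM lee_fin mulrC ler_wpM2l ?phi_ge0 // persist_nd.
apply: ge0_subset_integral => //=.
- by apply: measurable_kernel_integrand; exact: measurable_persist.
- by move=> z _; rewrite lee_fin mulr_ge0 ?phi_ge0 ?persist_ge0.
- by move=> z; rewrite /D /= !in_itv /= !andbT; exact: le_trans.
Qed.

(* [c (a^-n - 1)], with [c = r / (1 - a)], is the height from which [n] steps
   with noise at least [-r] cannot reach the negative half-line. *)
Lemma persist_far a n x (r : R) : 0 < a < 1 -> 0 <= r -> 0 <= 1 - expR (1 / 2 - r) ->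
  r / (1 - a) * (a ^- n - 1) <= x -> (1 - expR (1 / 2 - r)) ^+ n <= persist a n x.
Proof.
move=> /andP[a0 a1] r0 q0; elim: n x => [|n IH] x xn; first by rewrite expr0.
have c0 : 0 <= r / (1 - a) by rewrite divr_ge0 // subr_ge0 ltW.
have H : r / (1 - a) * (a ^- n - 1) <= a * x - r.
  have := ler_wpM2l (ltW a0) xn.
  have -> : a * (r / (1 - a) * (a ^- n.+1 - 1)) = r / (1 - a) * (a ^- n - 1) + r.
    rewrite exprS invfM; field.
    by rewrite !gt_eqF ?exprn_gt0 ?subr_gt0.
  lra.
have y0 : 0 <= a * x - r.
  apply: le_trans H; rewrite mulr_ge0 // subr_ge0 invf_ge1 ?exprn_gt0 //.
  by rewrite exprn_ile1 // ltW.
apply: le_trans (persistS_descent n (ltW a0) y0).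
by rewrite exprS ler_wpM2l // IH.
Qed.

(** Chosen so that [climb_cost * expR (u ^+ 2 / 2 + u)] is the inverse of [phi (u + 1)], the density
    factor of [persistS_ge]. *)
Definition climb_cost : R := expR (1 / 2) / normal_peak 1.

Lemma climb_cost_gt0 : 0 < climb_cost.
Proof. by rewrite divr_gt0 ?expR_gt0 ?normal_peak1_gt0. Qed.

Let persist_climb1 a n x y u : 0 <= a -> 0 <= x -> 2 * (a * y) <= 2 * x + 1 -> x - a * y = u ->
  persist a n x <= climb_cost * expR (u ^+ 2 / 2 + u) * persist a n.+1 y.
Proof.
move=> a0 x0 xy ux; have := persistS_ge n a0 x0 xy.
have -> : x + 1 - a * y = u + 1 by rewrite -ux; ring.
rewrite mulrC -ler_pdivlMr ?phi_gt0 // => /le_trans; apply.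
rewrite mulrC le_eqVlt; apply/orP; left; apply/eqP; congr (_ * _).
rewrite phiE /climb_cost invfM -expRN [RHS]mulrAC mulrC; congr (_ / _).
by rewrite -expRD; congr expR; field.
Qed.

(* Reach [x] from [0] along [a^j x, ..., a x, x]; its cost is that of the
   stationary density up to the vanishing term [a^(2 j + 2)]. *)
Lemma persist_climb a j n x : 0 <= a < 1 -> 0 <= x ->
  persist a n x <= climb_cost ^+ j.+1 *
    expR ((1 - a ^+ 2 + a ^+ (2 * j.+1)) * x ^+ 2 / 2 + 2 * x) * persist a (n + j.+1) 0.
Proof.
move=> /andP[a0 a1]; have cc := climb_cost_gt0.
elim: j n x => [|j IH] n x x0.
  rewrite expr1 addn1; apply: le_trans (persist_climb1 (y := 0) (u := x) n a0 x0 _ _) _.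
  - lra.
  - by rewrite mulr0 subr0.
  - rewrite ler_wpM2r ?persist_ge0 // (ler_wpM2l (ltW cc)) // ler_expR muln1 subrK mul1r.
    lra.
have ax0 : 0 <= a * x by rewrite mulr_ge0.
have a2 : a ^+ 2 <= 1 by rewrite exprn_ile1 // ltW.
apply: le_trans (persist_climb1 (y := a * x) (u := (1 - a ^+ 2) * x) n a0 x0 _ _) _.
- have : a ^+ 2 * x <= 1 * x by rewrite ler_wpM2r.
  have -> : a * (a * x) = a ^+ 2 * x by ring.
  lra.
- ring.
- have H := IH n.+1 _ ax0; rewrite addSnnS in H.
  apply: le_trans (ler_wpM2l _ H) _; first by rewrite mulr_ge0 ?expR_ge0 // ltW.
  set A := expR (((1 - a ^+ 2) * x) ^+ 2 / 2 + _).
  set B := expR (_ * (a * x) ^+ 2 / 2 + _); set P := persist _ _ _.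
  have -> : climb_cost * A * (climb_cost ^+ j.+1 * B * P) = climb_cost ^+ j.+2 * (A * B) * P.
    by rewrite [climb_cost ^+ j.+2]exprS; ring.
  apply: ler_wpM2r; first exact: persist_ge0.
  apply: ler_wpM2l; first by rewrite exprn_ge0 // ltW.
  rewrite -expRD ler_expR.
  (* The jump from [a * x] to [x] uses noise [(1 - a ^+ 2) * x]. Added to the climb up to [a * x],
     it gives the recursion [v_(j+1) = (1 - a^2)^2 + a^2 v_j]. *)
  have -> : (1 - a ^+ 2 + a ^+ (2 * j.+2)) * x ^+ 2 / 2 =
    ((1 - a ^+ 2) * x) ^+ 2 / 2 + (1 - a ^+ 2 + a ^+ (2 * j.+1)) * (a * x) ^+ 2 / 2.
    have -> : a ^+ (2 * j.+2) = a ^+ 2 * a ^+ (2 * j.+1) by rewrite -exprD mulnS.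
    by field.
  (* The linear terms [(1 - a^2) x + 2 a x] stay below [2 x] because [(1 - a)^2 >= 0]. *)
  have K : 0 <= (2 - (1 - a ^+ 2) - 2 * a) * x.
    by rewrite mulr_ge0 //; have := sqr_ge0 (1 - a); lra.
  lra.
Qed.

(** Weighing the climbing bound by [1 - t] and the trivial bound 1 by [t] turns the coefficient
    [(1 + t) g] into [(1 - t^2) g], which leaves room below [g = 1 - a^2]. *)
Lemma persist_upper a (t : R) : 0 <= a < 1 -> 0 < t < 1 ->
  exists C b : R, 0 < b < 1 - a ^+ 2 /\
    forall n x, 0 <= x ->
      persist a n x <= expR (C + n%:R * ((1 - t) * log_theta a) + b * x ^+ 2 / 2).
Proof.
move=> a01 /andP[t0 t1]; have /andP[a0 a1] := a01.
set g := 1 - a ^+ 2.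
have g0 : 0 < g by rewrite subr_gt0 exprn_ilt1.
(* Enough climbing steps to make the vanishing term of [persist_climb] at most [t * g]. *)
have [j hj] := exists_exp_lt a01 (mulr_gt0 t0 g0).
have hj2 : a ^+ (2 * j.+1) <= t * g.
  apply/ltW/(le_lt_trans _ hj); rewrite (ler_wiXn2l a0 (ltW a1)) //.
  by rewrite mulnS (leq_trans (leq_pmull j (isT : 0 < 2)%N)) // leq_addl.
(* Half of the room [t^2 g], spent on absorbing the linear term by [2 x <= e x^2 / 2 + 2 / e]. *)
set e := t ^+ 2 * g / 2.
have e0 : 0 < e by rewrite divr_gt0 // mulr_gt0 // exprn_gt0.
exists (j.+1%:R * `|ln climb_cost| + 2 / e), ((1 - t ^+ 2 / 2) * g); split.
  have t2 : 0 < t ^+ 2 < 1 by rewrite exprn_gt0 //= exprn_ilt1 // ltW.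
  by rewrite mulr_gt0 //=; [nra|lra].
move=> n x x0; set p := persist a n x.
have p0 : 0 < p by exact: persist_gt0.
have lp : ln p <= 0 by rewrite ln_le0 // persist_le1.
rewrite -[leLHS]lnK // ler_expR.
have H : ln p <= j.+1%:R * ln climb_cost + ((g + a ^+ (2 * j.+1)) * x ^+ 2 / 2 + 2 * x)
    + (n + j.+1)%:R * log_theta a.
  rewrite -ler_expR lnK // !expRD expRM_natl lnK ?posrE ?climb_cost_gt0 //.
  rewrite -expRD; apply: le_trans (persist_climb j n a01 x0) _.
  apply: ler_wpM2l; last exact: persist0_le.
  by rewrite mulr_ge0 ?expR_ge0 // exprn_ge0 // ltW // climb_cost_gt0.
have l0 := log_theta_le0 a0.
have H1 : (n + j.+1)%:R * log_theta a <= n%:R * log_theta a.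
  by rewrite natrD mulrDl gerDl mulr_ge0_le0.
have H2 : j.+1%:R * ln climb_cost <= j.+1%:R * `|ln climb_cost|.
  by rewrite ler_wpM2l // ler_norm.
have H3 : a ^+ (2 * j.+1) * x ^+ 2 <= t * g * x ^+ 2 by rewrite ler_wpM2r // sqr_ge0.
have H4 : 2 * x <= e * x ^+ 2 / 2 + 2 / e.
  have : 0 <= (e * x - 2) ^+ 2 / (2 * e) by rewrite divr_ge0 ?sqr_ge0 // mulr_ge0 // ltW.
  have -> : (e * x - 2) ^+ 2 / (2 * e) = e * x ^+ 2 / 2 + 2 / e - 2 * x.
    field; exact: lt0r_neq0.
  by rewrite subr_ge0.
set K := j.+1%:R * `|ln climb_cost| in H2 *.
have K0 : 0 <= K by rewrite mulr_ge0.
have e20 : 0 <= 2 / e by rewrite divr_ge0 // ltW.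
have H5 : ln p <= K + ((g + t * g) * x ^+ 2 / 2 + e * x ^+ 2 / 2 + 2 / e) + n%:R * log_theta a.
  lra.
have H6 : (1 - t) * ln p <= (1 - t) * (K + ((g + t * g) * x ^+ 2 / 2 + e * x ^+ 2 / 2 + 2 / e) + n%:R * log_theta a).
  by rewrite ler_wpM2l // subr_ge0 ltW.
have H7 : t * ln p <= 0 by rewrite mulr_ge0_le0 // ltW.
have H8 : 0 <= t * K by rewrite mulr_ge0 // ltW.
have H9 : 0 <= t * (2 / e) by rewrite mulr_ge0 // ltW.
have H10 : 0 <= t * (e * x ^+ 2 / 2).
  by rewrite mulr_ge0 ?divr_ge0 ?mulr_ge0 ?sqr_ge0 // ltW.
have E1 : (1 - t) * ((g + t * g) * x ^+ 2 / 2) + e * x ^+ 2 / 2 =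
   (1 - t ^+ 2 / 2) * g * x ^+ 2 / 2 by rewrite /e; field.
lra.
Qed.

End persistence_estimates.

(** * High starts, strict decay, and dependence on the parameter *)

Section log_theta_properties.
Context {R : realType}.
Notation mu := (@lebesgue_measure R).
Local Notation Rplus := ([set` `[0%R, +oo[] : set R).
Implicit Types a x y z : R.

(* The rates [b_k = a^(2k) / (a^(2k) u + w)] with [u = 1 / (1 - a^2)] are an orbit of
   [b |-> a^2 b / (1 - b)], the action of one step on [exp (b x^2 / 2)]. *)
Lemma persist_upper_far a (t : R) : 0 < a < 1 -> 0 < t < 1 ->
  exists C B : R, 0 <= B /\
    forall n k x, 0 <= x <= a ^- k ->
      persist a (n + k) x <= expR (C + k%:R * B + n%:R * ((1 - t) * log_theta a)).
Proof.
move=> /andP[a0 a1] t01; have a01 : 0 <= a < 1 by rewrite ltW.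
have [C [b [/andP[b0 bg] H]]] := persist_upper a01 t01.
have a2 : 0 < a ^+ 2 < 1 by rewrite exprn_gt0 //= exprn_ilt1 // ltW.
set g := 1 - a ^+ 2 in bg *; have g0 : 0 < g by rewrite subr_gt0; case/andP: a2.
(* [w] is fixed by [bb 0 = b], and is positive because [b < g]. *)
pose w := b^-1 - g^-1; have w0 : 0 < w by rewrite subr_gt0 ltf_pV2.
pose A k := a ^+ (2 * k); have A0 k : 0 < A k by rewrite exprn_gt0.
have A1 k : A k <= 1 by rewrite exprn_ile1 // ltW.
pose bb k := A k / (A k / g + w).
have den k : 0 < A k / g + w by rewrite addr_gt0 // divr_gt0.
have bbE : bb 0%N = b.
  have E : 1 / g + w = b^-1 by rewrite /w; ring.
  by rewrite /bb /A muln0 expr0 E div1r invrK.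
have bbb k : bb k <= b.
  rewrite /bb ler_pdivrMr // mulrDr -[leLHS]mulr1 -[leLHS](@mulfK _ b) ?gt_eqF //.
  have -> : A k * 1 * b / b = b * (A k / g) + b * (w * A k).
    rewrite /w; field; by rewrite !gt_eqF.
  by rewrite lerD2l (ler_wpM2l (ltW b0)) // ler_piMr // ltW.
have b1 : b < 1 by apply: lt_trans bg _; rewrite gtrBl; case/andP: a2.
have bb1 k : bb k < 1 by apply: le_lt_trans (bbb k) b1.
have bbS k : a ^+ 2 * bb k / (1 - bb k) = bb k.+1.
  have AS : A k.+1 = a ^+ 2 * A k by rewrite /A mulnS exprD.
  have E1 : 1 - bb k = (A k.+1 / g + w) / (A k / g + w).
    rewrite /bb AS /g; field.
    by rewrite -/g !gt_eqF // addr_gt0 // mulr_gt0.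
  rewrite E1 {1}/bb /bb AS.
  have := den k; have := den k.+1; rewrite AS; move: (_ + w) (_ + w) => d1 d2 d10 d20.
  by field; rewrite !gt_eqF.
(* Since [bb k <= b], a single factor [S] bounds the normalising constant of every step. *)
set S := Num.sqrt (1 - b)^-1.
have S1 : 1 <= S.
  by rewrite -sqrtr1 ler_wsqrtr // invf_ge1 ?subr_gt0 // gerBl ltW.
have S0 : 0 < S by exact: lt_le_trans S1.
have step n k x : 0 <= x -> persist a (n + k) x <=
    expR (C + k%:R * ln S + n%:R * ((1 - t) * log_theta a)) * expR (bb k * x ^+ 2 / 2).
  elim: k x => [|k IH] x x0.
    by rewrite addn0 bbE mul0r addr0 -expRD H.
  set c := expR (C + k%:R * ln S + n%:R * ((1 - t) * log_theta a)) in IH.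
  have c0 : 0 <= c by exact: expR_ge0.
  rewrite addnS -lee_fin (persistS _ _ (ltW a0)).
  apply: (@le_trans _ _ (kernel_op a (fun z => c * expR (bb k * z ^+ 2 / 2))%R x)).
    apply: kernel_op_le.
    - by apply: measurable_persist; exact: ltW.
    - apply: measurable_funM => //; exact: measurable_expR_sqr.
    - by move=> z z0; rewrite (persist_ge0 _ _ (ltW a0)) /= IH.
  rewrite kernel_opZ //; last exact: measurable_expR_sqr.
  apply: (@le_trans _ _ (c%:E * (S * expR (bb k.+1 * x ^+ 2 / 2))%:E)%E).
    apply: lee_wpmul2l; first by rewrite lee_fin.
    apply: le_trans (kernel_op_expR_sqr a x (bb1 k)) _.
    rewrite bbS lee_fin ler_wpM2r ?expR_ge0 // ler_wsqrtr // lef_pV2 ?posrE ?subr_gt0 //.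
    by rewrite lerD2l lerN2.
  rewrite -EFinM lee_fin [c * _]mulrA; apply: ler_wpM2r; first exact: expR_ge0.
  rewrite /c -[X in _ * X <= _](@lnK _ S) //.
  by rewrite -expRD ler_expR -[k.+1]addn1 natrD; lra.
exists (C + (2 * w)^-1), (ln S); split; first exact: ln_ge0.
move=> n k x /andP[x0 xk]; apply: le_trans (step n k x x0) _.
rewrite -expRD ler_expR.
(* [bb k] decays like [a^(2 k)], which compensates the square of a start below [a^-k]. *)
suff : bb k * x ^+ 2 / 2 <= (2 * w)^-1 by lra.
have h1 : bb k <= A k / w.
  rewrite /bb ler_pM2l // lef_pV2 ?posrE // lerDr divr_ge0 // ltW //.
have h2 : A k * x ^+ 2 <= 1.
  rewrite /A mulnC exprM -exprMn exprn_ile1 //; first by rewrite mulr_ge0 // exprn_ge0 // ltW.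
  by rewrite mulrC -ler_pdivlMr ?exprn_gt0 // div1r.
have h3 : bb k * x ^+ 2 <= A k / w * x ^+ 2 by rewrite ler_wpM2r // sqr_ge0.
have h4 : A k / w * x ^+ 2 <= w^-1.
  by rewrite mulrAC -[leRHS]mul1r ler_wpM2r // invr_ge0 ltW.
rewrite invfM; lra.
Qed.

(** The first step lands in [[-1, 0[] with probability at least [phi (1 + a * x)]. *)
Lemma persist1_lt1 a x : 0 <= a -> 0 <= x -> persist a 1 x < 1.
Proof.
move=> a0 x0; set m := a * x; have m0 : 0 <= m by rewrite mulr_ge0.
have mphi (D : set R) : measurable_fun D (fun z => (phi (z - m))%:E).
  by apply/measurable_EFinP; apply: measurable_funTS; exact: measurable_phi_shift.
suff : (persist a 1 x + phi (1 + m) <= 1) by have := phi_gt0 (1 + m); lra.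
rewrite -lee_fin EFinD persistS // -(integral_phi_shift m).
have -> : (kernel_op a (persist a 0) x = \int[mu]_(z in Rplus) (phi (z - m))%:E)%E.
  by rewrite /kernel_op; apply: eq_integral => z _; rewrite mulr1.
pose D := [set` `[-1, 0[] : set R.
have mD : measurable D by exact: measurable_itv.
apply: (@le_trans _ _ (\int[mu]_(z in Rplus) (phi (z - m))%:E + \int[mu]_(z in D) (phi (z - m))%:E)%E).
  apply: leeD2l.
  have -> : ((phi (1 + m))%:E = \int[mu]_(z in D) (phi (1 + m))%:E)%E.
    rewrite integral_cst //= /D lebesgue_measure_itv /= lte_fin ltrN10 -EFinD.
    by rewrite sub0r opprK mule1.
  apply: ge0_le_integral => //=.
  - by move=> z _; rewrite lee_fin phi_ge0.
  - exact: mphi.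
  - move=> z; rewrite /D /= in_itv /= => /andP[z1 z0]; rewrite lee_fin; apply: phi_le.
    rewrite (ger0_norm (_ : 0 <= 1 + m)) ?ler_norml; lra.
rewrite -ge0_integral_setU //=; last first.
- rewrite disj_set2E; apply/eqP/seteqP; split=> // z [].
  by rewrite /D /= !in_itv /= andbT => h /andP[_]; rewrite ltNge h.
- by move=> z _; rewrite lee_fin phi_ge0.
- exact: mphi.
apply: ge0_subset_integral => //=.
- exact: measurableU.
- exact: mphi.
by move=> z _; rewrite lee_fin phi_ge0.
Qed.

(* [exp (b x^2 / 2)] is a Lyapunov function when [b] is small: by Cauchy-Schwarz its image
   at [x] is at most the square root of [persist a 1 x] times the image of [exp (b x^2)]. *)
Lemma log_theta_lt0 a : 0 <= a < 1 -> log_theta a < 0.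
Proof.
move=> /andP[a0 a1].
have a2 : 0 <= a ^+ 2 < 1 by rewrite exprn_ge0 //= exprn_ilt1.
set g := 1 - a ^+ 2; have g0 : 0 < g by rewrite subr_gt0; case/andP: a2.
have g1 : g <= 1 by rewrite gerBl; case/andP: a2.
(* [X] and [b] are calibrated for the case split on [x] below: [g X^2 = 8] and
   [ln (persist a 1 X) <= - 4 b]. *)
set X := Num.sqrt (8 / g); have X0 : 0 <= X by exact: sqrtr_ge0.
have X2 : X ^+ 2 = 8 / g by rewrite sqr_sqrtr // divr_ge0 // ltW.
set L := ln (persist a 1 X).
have L0 : L < 0 by apply: ln_lt0; rewrite persist_gt0 //= persist1_lt1.
set b := Num.min (g / 4) (- L / 4).
have b0 : 0 < b by rewrite lt_min !divr_gt0 // oppr_gt0.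
have bg : b <= g / 4 by rewrite ge_min lexx.
have bL : b <= - L / 4 by rewrite ge_min lexx orbT.
have b2 : 0 < 1 - 2 * b by lra.
have key x : 0 <= x -> (1 - 1 / 2) * ln (persist a 1 x) + 1 / 2 *
    ln (Num.sqrt (1 - 2 * b)^-1 * expR (a ^+ 2 * (2 * b) / (1 - 2 * b) * x ^+ 2 / 2))
    <= - b + b * x ^+ 2 / 2.
  move=> x0; rewrite lnM ?posrE ?expR_gt0 ?sqrtr_gt0 ?invr_gt0 // expRK.
  have h1 : ln (Num.sqrt (1 - 2 * b)^-1) <= 2 * b.
    have s0 : 0 < Num.sqrt (1 - 2 * b)^-1 by rewrite sqrtr_gt0 invr_gt0.
    have E : ln (Num.sqrt (1 - 2 * b)^-1) * 2 = ln (1 - 2 * b)^-1.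
      by rewrite -[in RHS](sqr_sqrtr (_ : 0 <= (1 - 2 * b)^-1)) ?invr_ge0 ?ltW // lnXn // mulr_natr.
    have : ln (1 - 2 * b)^-1 <= 4 * b.
      have -> : (1 - 2 * b)^-1 = 1 + 2 * b / (1 - 2 * b) by field; exact: lt0r_neq0.
      have q0 : 0 <= 2 * b / (1 - 2 * b) by rewrite divr_ge0 ?mulr_ge0 // ltW.
      apply: le_trans (le_ln1Dx _) _; first lra.
      by rewrite ler_pdivrMr //; nra.
    lra.
  (* Since [2 b <= g / 2], this follows from [a^2 = 1 - g <= (1 - g / 2)^2]. *)
  have h2 : a ^+ 2 * (2 * b) / (1 - 2 * b) <= 2 * b * (1 - g / 2).
    rewrite ler_pdivrMr // -[leRHS]mulrA [leLHS]mulrC ler_pM2l ?mulr_gt0 //.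
    have -> : a ^+ 2 = 1 - g by rewrite /g; ring.
    have : (1 - g / 2) * (1 - g / 2) <= (1 - g / 2) * (1 - 2 * b) by apply: ler_wpM2l; lra.
    have : 0 <= g ^+ 2 by exact: sqr_ge0.
    have -> : (1 - g / 2) * (1 - g / 2) = 1 - g + g ^+ 2 / 4 by field.
    lra.
  have h3 : a ^+ 2 * (2 * b) / (1 - 2 * b) * x ^+ 2 <= 2 * b * (1 - g / 2) * x ^+ 2.
    by rewrite ler_wpM2r // sqr_ge0.
  set l := ln (persist a 1 x).
  suff : l / 2 + b - b * g * x ^+ 2 / 4 <= - b.
    lra.
  (* Up to [X], killing in one step gives [l / 2 <= - 2 b]; beyond, contraction gives
     [b g x^2 / 4 >= 2 b]. *)
  case: (leP x X) => xX.
    have lL : l <= L by rewrite ler_ln ?posrE; [exact: persist_nd|exact: persist_gt0|exact: persist_gt0].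
    have : 0 <= b * g * x ^+ 2 by rewrite !mulr_ge0 ?sqr_ge0 // ltW.
    lra.
  have l0 : l <= 0 by rewrite ln_le0 // persist_le1.
  have : b * 8 <= b * g * x ^+ 2.
    rewrite -mulrA ler_pM2l // mulrC -ler_pdivrMr // -X2.
    by rewrite lerXn2r ?nnegrE // ltW.
  lra.
have step n x : 0 <= x -> persist a n x <= expR (n%:R * - b) * expR (b * x ^+ 2 / 2).
  elim: n x => [|n IH] x x0.
    rewrite mul0r expR0 mul1r -[leLHS]expR0 ler_expR.
    by rewrite divr_ge0 // mulr_ge0 ?sqr_ge0 // ltW.
  set c := expR (n%:R * - b) in IH; have c0 : 0 <= c by exact: expR_ge0.
  rewrite -lee_fin (persistS _ _ a0).
  apply: (@le_trans _ _ (kernel_op a (fun z => c * expR (b * z ^+ 2 / 2))%R x)).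
    apply: kernel_op_le.
    - exact: measurable_persist.
    - apply: measurable_funM => //; exact: measurable_expR_sqr.
    - by move=> z z0; rewrite persist_ge0 //= IH.
  rewrite kernel_opZ //; last exact: measurable_expR_sqr.
  apply: (@le_trans _ _ (c%:E * (expR (- b + b * x ^+ 2 / 2))%:E)%E); last first.
    rewrite -EFinM lee_fin /c -!expRD ler_expR -[n.+1]addn1 natrD; lra.
  apply: lee_wpmul2l; first by rewrite lee_fin.
  apply: (@le_trans _ _ (expR ((1 - 1 / 2) * ln (persist a 1 x) + 1 / 2 *
    ln (Num.sqrt (1 - 2 * b)^-1 * expR (a ^+ 2 * (2 * b) / (1 - 2 * b) * x ^+ 2 / 2))))%:E); last first.
    by rewrite lee_fin ler_expR key.
  apply: (@log_hoelder _ _ (fun z => phi (z - a * x) * persist a 0 z)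
     (fun z => phi (z - a * x) * expR (2 * b * z ^+ 2 / 2))).
  - exact: measurable_itv.
  - apply: measurable_funM; [exact: measurable_phi_shift|exact: measurable_persist].
  - apply: measurable_funM; [exact: measurable_phi_shift|exact: measurable_expR_sqr].
  - apply: measurable_funM; [exact: measurable_phi_shift|exact: measurable_expR_sqr].
  - lra.
  - exact: persist_gt0.
  - by rewrite mulr_gt0 ?expR_gt0 // sqrtr_gt0 invr_gt0.
  - by move=> z _; rewrite mulr1 phi_gt0.
  - by move=> z _; rewrite mulr_gt0 ?phi_gt0 ?expR_gt0.
  - move=> z _; rewrite mulr_ge0 ?phi_ge0 ?expR_ge0 //= mulr1 lnM ?posrE ?phi_gt0 ?expR_gt0 //.
    rewrite expRK -[X in X * _](@lnK _ (phi (z - a * x))) ?posrE ?phi_gt0 // -expRD ler_expR.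
    lra.
  - by rewrite (persistS 0 x a0).
  - by apply: kernel_op_expR_sqr; lra.
apply: (@le_lt_trans _ _ (- b)); last by rewrite oppr_lt0.
apply: ge_sup; first by exists (ln (persist a 1 0) / 1%:R); exists 0%N.
move=> _ [n _ <-]; rewrite ler_pdivrMr // mulrC -ler_expR lnK ?posrE ?persist_gt0 //.
by have := step n.+1 0 (lexx 0); rewrite expr0n /= mulr0 mul0r expR0 mulr1.
Qed.

(* Change of parameter along [a + t d] by Hoelder's inequality between [phi (z - a x)] and
   [phi (z - (a + d) x)]. *)
Lemma persist_perturb a (d t e : R) n x : 0 <= a -> 0 <= a + t * d -> 0 <= t <= 1 ->
  0 <= e < 1 -> d ^+ 2 + (a + d) ^+ 2 * e / (1 - e) <= e -> 0 <= x ->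
  persist (a + t * d) n x <=
  expR ((1 - t) * ln (persist a n x) +
        t * (n%:R * ln (Num.sqrt (1 - e)^-1) + e * x ^+ 2 / 2)).
Proof.
move=> a0 b0 t01 /andP[e0 e1] de; have /andP[t0 t1] := t01.
have k0 : 0 < 1 - e by rewrite subr_gt0.
set s := Num.sqrt (1 - e)^-1; have s0 : 0 < s by rewrite sqrtr_gt0 invr_gt0.
elim: n x => [|n IH] x x0.
  rewrite ln1 mulr0 mul0r !add0r -[leLHS]expR0 ler_expR.
  by rewrite mulr_ge0 // divr_ge0 // mulr_ge0 ?sqr_ge0.
rewrite -lee_fin persistS //.
(* The density at parameter [a + t d] is the geometric mean of those at [a] and [a + d], times
   [exp (t (1 - t) d^2 x^2 / 2)]. The term [d ^+ 2 * x ^+ 2 / 2], which enters with weight [t], pays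
   for this factor. *)
pose c := expR (n%:R * ln s + d ^+ 2 * x ^+ 2 / 2).
pose f z := phi (z - a * x) * persist a n z.
pose g z := c * (phi (z - (a + d) * x) * expR (e * z ^+ 2 / 2)).
pose G := c * (s * expR ((a + d) ^+ 2 * e / (1 - e) * x ^+ 2 / 2)).
have G0 : 0 < G by rewrite !mulr_gt0 ?expR_gt0.
apply: (@le_trans _ _ (expR ((1 - t) * ln (persist a n.+1 x) + t * ln G))%:E); last first.
  rewrite lee_fin ler_expR lerD2l ler_wpM2l // /G !lnM ?posrE ?mulr_gt0 ?expR_gt0 //.
  rewrite !expRK -[n.+1]addn1 natrD.
  (* The hypothesis on [e] closes the induction: the quadratic coefficient does not grow. *)
  have : (d ^+ 2 + (a + d) ^+ 2 * e / (1 - e)) * x ^+ 2 <= e * x ^+ 2.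
    by rewrite ler_wpM2r // sqr_ge0.
  lra.
have mg : measurable_fun [set: R] (fun z => phi (z - (a + d) * x) * expR (e * z ^+ 2 / 2)).
  apply: measurable_funM; [exact: measurable_phi_shift|exact: measurable_expR_sqr].
apply: (@log_hoelder _ _ f g).
- exact: measurable_itv.
- apply: measurable_funM; [exact: measurable_phi_shift|exact: measurable_persist].
- exact: measurable_funM.
- apply: measurable_funM; [exact: measurable_phi_shift|exact: measurable_persist].
- exact: t01.
- exact: persist_gt0.
- exact: G0.
- move=> z; rewrite /= in_itv /= andbT => z0; by rewrite /f mulr_gt0 ?phi_gt0 ?persist_gt0.
- move=> z _; by rewrite /g !mulr_gt0 ?phi_gt0 ?expR_gt0.
- move=> z; rewrite /= in_itv /= andbT => z0.
  rewrite mulr_ge0 ?phi_ge0 ?persist_ge0 //=.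
  apply: le_trans (ler_wpM2l (phi_ge0 _) (IH z z0)) _.
  rewrite /f /g !lnM ?posrE ?mulr_gt0 ?phi_gt0 ?expR_gt0 ?persist_gt0 // !expRK.
  rewrite -[X in X * _](@lnK _ (phi _)) ?posrE ?phi_gt0 // -expRD ler_expR.
  rewrite !phiE !lnM ?posrE ?normal_peak1_gt0 ?expR_gt0 // !expRK.
  set q := ln (persist a n z); set P := ln (normal_peak 1).
  have : 0 <= t ^+ 2 * (d * x) ^+ 2 by rewrite mulr_ge0 ?sqr_ge0.
  move=> h; rewrite -subr_ge0 [X in 0 <= X](_ : _ = t ^+ 2 * (d * x) ^+ 2 / 2); last by field.
  lra.
- by rewrite (persistS n x a0).
- have : (kernel_op (a + d) (fun z => c * expR (e * z ^+ 2 / 2))%R x <= G%:E)%E.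
    rewrite kernel_opZ ?expR_ge0 //; last exact: measurable_expR_sqr.
    rewrite /G EFinM; apply: lee_wpmul2l; first by rewrite lee_fin expR_ge0.
    exact: kernel_op_expR_sqr.
  apply: le_trans; rewrite le_eqVlt; apply/orP; left; apply/eqP.
  by apply: eq_integral => z _; congr EFin; rewrite /g; ring.
Qed.

Lemma log_theta_perturb a (d t e : R) : 0 <= a -> 0 <= a + t * d -> 0 <= t <= 1 ->
  0 <= e < 1 -> d ^+ 2 + (a + d) ^+ 2 * e / (1 - e) <= e ->
  log_theta (a + t * d) <= (1 - t) * log_theta a + t * ln (Num.sqrt (1 - e)^-1).
Proof.
move=> a0 b0 t01 e01 de; apply: ge_sup; first by exists (ln (persist (a + t * d) 1 0) / 1%:R); exists 0%N.
move=> _ [n _ <-]; rewrite ler_pdivrMr // -ler_expR lnK ?posrE ?persist_gt0 //.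
apply: le_trans (persist_perturb n.+1 a0 b0 t01 e01 de (lexx 0)) _.
rewrite ler_expR expr0n /= mulr0 mul0r addr0.
have : ln (persist a n.+1 0) <= n.+1%:R * log_theta a.
  by rewrite -ler_expR lnK ?posrE ?persist_gt0 // persist0_le.
case/andP: t01 => _; rewrite -subr_ge0 => t1 /(ler_wpM2l t1).
lra.
Qed.

(** Going from [a] to [b] is moving by the fraction [t = |b - a| / e] of a displacement of fixed
    size [e]; the increment is at most [t (c - log_theta a)], and [log_theta a >= ln (phi 1)]
    uniformly. A one-sided bound suffices, as [a] and [b] can be exchanged. *)
Lemma log_theta_lipschitz (A : R) : 0 <= A < 1 -> exists d L : R, [/\ 0 < d, 0 <= L &
  forall a b, 0 <= a <= A -> 0 <= b <= A -> `|b - a| <= d ->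
    log_theta b - log_theta a <= `|b - a| * L].
Proof.
move=> /andP[A0 A1]; set k := 1 - A; have k0 : 0 < k by rewrite subr_gt0.
(* Then [A = 1 - 4 e], so a displacement of size [e] keeps [|a + d| <= 1 - 3 e]. *)
set e := k / 4; set c := ln (Num.sqrt (1 - e)^-1).
have e01 : 0 <= e < 1 by rewrite /e /k; lra.
have c0 : 0 <= c.
  case/andP: e01 => h1 h2; apply: ln_ge0; rewrite -[leLHS]sqrtr1 ler_wsqrtr //.
  by rewrite invf_ge1 ?subr_gt0 // gerBl.
have p0 := @ln_phi1_le0 R.
have d0 : 0 < e by rewrite divr_gt0.
exists e, ((c - ln (phi 1)) / e); split => //; first by apply: divr_ge0; [lra|exact: ltW].
move=> a b /andP[a0 aA] /andP[b0 bA] ab.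
have [->|neq] := eqVneq b a; first by rewrite !subrr normr0 mul0r.
have n0 : 0 < `|b - a| by rewrite normr_gt0 subr_eq0.
pose t := `|b - a| / e; pose d := (b - a) / t.
have t0 : 0 < t by rewrite divr_gt0.
have bE : a + t * d = b.
  by rewrite /d mulrCA divff ?mulr1 ?gt_eqF // addrC subrK.
have dE : `|d| = e.
  rewrite /d normrM normfV (ger0_norm (ltW t0)) /t invfM invrK mulrCA mulrA.
  by rewrite mulVf ?mul1r // gt_eqF.
have t01 : 0 <= t <= 1 by rewrite (ltW t0) /= ler_pdivrMr // mul1r.
have d2 : d ^+ 2 = e ^+ 2 by rewrite -[in RHS]dE real_normK // num_real.
have ad : (a + d) ^+ 2 <= 1 - 3 * e.
  have : `|a + d| <= 1 - 3 * e.
    apply: le_trans (ler_normD _ _) _; rewrite dE (ger0_norm a0) /e /k; rewrite /e /k in aA *; lra.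
  have q1 : 0 <= 1 - 3 * e <= 1 by rewrite /e /k; lra.
  move=> h; rewrite -[leLHS](real_normK (num_real _)).
  have h2 : `|a + d| * `|a + d| <= (1 - 3 * e) * 1.
    by apply: ler_pM => //; case/andP: q1 => _; exact: le_trans.
  by rewrite expr2; lra.
(* As [1 - 3 e <= (1 - 2 e) (1 - e)], the left side is at most [e^2 + e (1 - 2 e) = e - e^2]. *)
have H : d ^+ 2 + (a + d) ^+ 2 * e / (1 - e) <= e.
  have m0 : 0 < 1 - e by case/andP: e01; lra.
  have h : (a + d) ^+ 2 * e / (1 - e) <= e * (1 - 2 * e).
    rewrite ler_pdivrMr //.
    have : (a + d) ^+ 2 * e <= (1 - 3 * e) * e by rewrite ler_wpM2r // ltW.
    have : 0 <= e * (2 * e ^+ 2) by rewrite !mulr_ge0 ?sqr_ge0 // ltW.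
    lra.
  rewrite d2; have : 0 <= e ^+ 2 by exact: sqr_ge0.
  lra.
have := log_theta_perturb a0 (_ : 0 <= a + t * d) t01 e01 H.
rewrite bE -/c => /(_ b0) h.
have hl := log_theta_ge a0.
have h2 : t * (c - log_theta a) <= t * (c - ln (phi 1)).
  by rewrite ler_wpM2l ?(ltW t0) //; lra.
have -> : `|b - a| * ((c - ln (phi 1)) / e) = t * (c - ln (phi 1)) by rewrite /t; ring.
lra.
Qed.

End log_theta_properties.

(** * From the process to the transition kernel *)

Section gaussian_integral.
Context {R : realType}.
Notation mu := (@lebesgue_measure R).

(** The Radon-Nikodym derivative is identified with the density almost everywhere, because both have
    the same integral over every measurable set. *)
Lemma ge0_integral_normal (m s : R) (f : R -> \bar R) : measurable_fun [set: R] f ->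
  (forall y, 0 <= f y)%E ->
  (\int[normal_prob m s]_y f y = \int[mu]_y (f y * (normal_pdf m s y)%:E))%E.
Proof.
move=> mf f0.
have dom : normal_prob m s `<< mu by exact: normal_prob_dominates.
rewrite -(@Radon_Nikodym_SigmaFinite.change_of_variables _ _ _ (normal_prob m s) mu dom) //.
have mpdf : measurable_fun [set: R] (fun y => (normal_pdf m s y)%:E).
  by apply/measurable_EFinP; exact: measurable_normal_pdf.
apply: ae_eq_integral => //.
- apply: emeasurable_funM => //.
  exact: measurable_int (Radon_Nikodym_SigmaFinite.f_integrable dom).
- exact: emeasurable_funM.
apply: ae_eqe_mul2l; apply: integral_ae_eq => //.
- exact: Radon_Nikodym_SigmaFinite.f_integrable.
- by move=> E _ mE; rewrite -Radon_Nikodym_SigmaFinite.f_integral.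
Qed.
End gaussian_integral.

(** * Independence and product measures *)

Section independence.
Context {R : realType} (d : measure_display) (T : measurableType d) (P : probability T R).

(** Factorisation on rectangles identifies the joint law with the product of the marginals, to which
    Tonelli's theorem applies. *)
Lemma independent_fubini (X Y : {RV P >-> R}) (f : R * R -> \bar R) :
  (forall A B : set R, measurable A -> measurable B ->
    P (X @^-1` A `&` Y @^-1` B) = (P (X @^-1` A) * P (Y @^-1` B))%E) ->
  measurable_fun [set: R * R] f -> (forall z, 0 <= f z)%E ->
  (\int[P]_w f (X w, Y w) =
   \int[P]_w \int[distribution P Y]_y f (X w, y))%E.
Proof.
move=> ind mf f0.
pose XY w := (X w, Y w).
have mXY : measurable_fun [set: T] XY by exact: measurable_fun_pair.
pose XY' : {mfun T >-> (R * R)%type} := HB.pack XY (isMeasurableFun.Build _ _ _ _ _ mXY).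
transitivity (\int[pushforward P XY']_z f z)%E.
  by rewrite ge0_integral_pushforward.
transitivity (\int[(distribution P X \x distribution P Y)%E]_z f z)%E.
  apply: eq_measure_integral => A mA _; apply/esym.
  exact: product_measure_unique.
rewrite fubini_tonelli1 // /fubini_F ge0_integral_pushforward //=.
- exact: measurable_fun_fubini_tonelli_F.
- by move=> x _; apply: integral_ge0.
Qed.

(* [distribution P X] lives on [R] and [law] on [measurableTypeR R]: same measurable sets,
   different displays. *)
Lemma ge0_integral_law (X : {RV P >-> R}) (law : probability (measurableTypeR R) R)
    (D : set R) (f : R -> \bar R) : has_law X law -> measurable D ->
  measurable_fun [set: R] f -> (forall x, 0 <= f x)%E ->
  (\int[distribution P X]_(x in D) f x = \int[law]_(x in D) f x)%E.
Proof.
move=> lawX mD mf f0.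
pose X1 : T -> measurableTypeR R := X.
have mX1 : measurable_fun [set: T] X1.
  by move=> _ B mB; exact: (measurable_funPT X measurableT B mB).
pose X2 : {mfun T >-> measurableTypeR R} := HB.pack X1 (isMeasurableFun.Build _ _ _ _ _ mX1).
pose f1 : measurableTypeR R -> \bar R := f.
have mf1 : measurable_fun [set: measurableTypeR R] f1 by exact: mf.
pose D1 : set (measurableTypeR R) := D.
have mD1 : measurable D1 by exact: mD.
transitivity (\int[pushforward P X2]_(x in D1) f1 x)%E.
  rewrite !ge0_integral_pushforward //; first exact: measurable_funTS.
  exact: measurable_funTS.
by apply: eq_measure_integral => B mB _; exact: lawX.
Qed.

End independence.

(** * The persistence probability in terms of the kernel *)

Section ar1_persistence.
Context {R : realType} (d : measure_display) (T : measurableType d) (P : probability T R).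
Variables (a : R) (law : probability (measurableTypeR R) R) (Z xi : nat -> {RV P >-> R}).
Hypothesis a0 : 0 <= a.
Hypothesis arZ : ar1_process a (gaussian 0 1) law Z xi.

(** Rectangle events in the inputs of index at most [n]: a pi-system generating the past. *)
Let past (n : nat) : set (set T) :=
  [set E | exists B : nat -> set R, (forall i, measurable (B i)) /\
     E = [set w | forall i, (i <= n)%N -> B i (ar1_inputs Z xi i w)]].

Let past_setI n : setI_closed (past n).
Proof.
move=> _ _ [B [mB ->]] [C [mC ->]]; exists (fun i => B i `&` C i); split.
  by move=> i; exact: measurableI.
apply/seteqP; split=> w /=; first by move=> [h1 h2] i ni; split; [exact: h1|exact: h2].
by move=> h; split=> i ni; case: (h i ni).
Qed.

Let past_prob n (B : nat -> set R) : (forall i, measurable (B i)) ->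
  P [set w | forall i, (i <= n)%N -> B i (ar1_inputs Z xi i w)] =
  (\prod_(i <- iota 0 n.+1) P (ar1_inputs Z xi i @^-1` B i))%E.
Proof.
move=> mB; pose J := seq_fset tt (iota 0 n.+1).
have JE i : (i \in J) = (i <= n)%N by rewrite seq_fsetE mem_iota add0n ltnS.
have JI : perm_eq J (iota 0 n.+1) by rewrite -[X in perm_eq _ X]undup_id ?iota_uniq ?seq_fset_perm.
rewrite -(perm_big _ JI) -(ar1_independent arZ J mB); congr (P _).
clearbody J; apply/seteqP; split=> w /=.
  by move=> h i /=; rewrite JE; exact: h.
by move=> h i ni; apply: h; rewrite /= JE.
Qed.

Let past_measurable n : past n `<=` measurable.
Proof.
move=> _ [B [mB ->]].
rewrite (_ : [set w | _] = \bigcap_(i in `I_n.+1) (ar1_inputs Z xi i @^-1` B i)); last first.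
  by apply/seteqP; split=> w /=.
by apply: fin_bigcap_measurable => // i _; rewrite -[X in measurable X]setTI; exact: measurable_funP.
Qed.

Let pastT n : past n setT.
Proof. by exists (fun=> setT); split=> //; apply/seteqP; split. Qed.

(** Both sides are finite measures in [E] that agree on the pi-system [past n], hence on the
    sigma-algebra it generates. *)
Let past_independent n E (C : set R) : measurable C -> <<s past n >> E ->
  P (E `&` xi n.+1 @^-1` C) = (P E * P (xi n.+1 @^-1` C))%E.
Proof.
move=> mC sE.
have mxC : measurable (xi n.+1 @^-1` C) by rewrite -[X in measurable X]setTI; exact: measurable_funP.
pose p : {nonneg R} := NngNum (fine_ge0 (measure_ge0 P (xi n.+1 @^-1` C))).
have pE : (p%:num)%:E = P (xi n.+1 @^-1` C) by rewrite /= fineK // fin_num_measure.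
transitivity (mscale p P E); last by rewrite /mscale /= pE muleC.
apply: (@g_sigma_algebra_measure_unique _ _ _ (past n) _ (fun=> setT) _ _ (mrestr P mxC) (mscale p P)) => //.
- by rewrite bigcup_const.
- move=> _ [B [mB ->]]; 
  set S := [set w | _]; transitivity (P (S `&` xi n.+1 @^-1` C)); first by [].
  transitivity (P S * P (xi n.+1 @^-1` C))%E; last by rewrite muleC -pE.
  rewrite /S.
  (* Extended by [C] at index [n.+1], the rectangle falls under [past_prob n.+1]. *)
  pose B' i := if (i <= n)%N then B i else C.
  have mB' i : measurable (B' i) by rewrite /B'; case: ifP.
  have := past_prob n.+1 mB'; rewrite -[n.+2]addn1 iotaD big_cat big_seq1 /= => h.
  rewrite (past_prob n mB).
  transitivity (P [set w | forall i, (i <= n.+1)%N -> B' i (ar1_inputs Z xi i w)]).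
    congr (P _); apply/seteqP; split=> w /=.
      move=> [h1 h2] i; rewrite leq_eqVlt => /orP[/eqP ->|]; first by rewrite /B' ltnn.
      by rewrite ltnS => ni; rewrite /B' ni; exact: h1.
    move=> h1; split=> [i ni|]; last by have := h1 n.+1 (leqnn _); rewrite /B' ltnn.
    by have := h1 i (leqW ni); rewrite /B' ni.
  rewrite h add0n /B' ltnn /=; congr (_ * _)%E.
  rewrite -[0%N :: _]/(iota 0 n.+1) big_seq [RHS]big_seq; apply: eq_bigr => i.
  by rewrite mem_iota add0n ltnS => /andP[_ ->].
- by move=> k; rewrite /= /mrestr setTI ltey_eq fin_num_measure.
Qed.

Definition nonneg_until (n : nat) : set T := [set w | forall i, (i <= n)%N -> 0 <= Z i w].

Lemma persistence_eventE n : persistence_event (fun i => Z i : T -> R) n = nonneg_until n.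
Proof.
apply/seteqP; split=> w /=; rewrite /persistence_event /= big_mkord.
  by move=> /bigmin_geP [_ h] i ni; have := h (Ordinal (ni : (i < n.+1)%N)) isT.
by move=> h; apply/bigmin_geP; split=> [|i _]; apply: h => //; rewrite -ltnS.
Qed.

Lemma nonneg_untilS n : nonneg_until n.+1 = nonneg_until n `&` [set w | 0 <= Z n.+1 w].
Proof.
apply/seteqP; split=> w /=.
  by move=> h; split; [move=> i ni; apply: h; exact: leqW|exact: h].
move=> [h1 h2] i; rewrite leq_eqVlt => /orP[/eqP ->//|]; exact: h1.
Qed.

(** [T] with the sigma-algebra of the past, so that dependence on the past alone is measurability on
    [G n]. *)
Let G n := g_sigma_algebraType (past n).

Let measurable_input n i : (i <= n)%N ->
  measurable_fun [set: G n] (ar1_inputs Z xi i : G n -> R).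
Proof.
move=> ni _ B mB; rewrite setTI; apply: sub_sigma_algebra.
exists (fun j => if j == i then B else setT); split=> [j|]; first by case: ifP.
apply/seteqP; split=> w /=; first by move=> h j _; case: ifP => // /eqP ->.
by move=> /(_ i ni); rewrite eqxx.
Qed.

Let measurable_past_Z n i : (i <= n)%N -> measurable_fun [set: G n] (Z i : G n -> R).
Proof.
elim: i => [|i IH] ni; first exact: (@measurable_input n 0).
rewrite (_ : (Z i.+1 : G n -> R) = (fun w => a * (Z i : G n -> R) w + (ar1_inputs Z xi i.+1 : G n -> R) w)).
  apply: measurable_funD; last exact: measurable_input.
  apply: measurable_funM => //; apply: IH; exact: ltnW.
by apply/funext => w; rewrite (ar1_recursion arZ).
Qed.

Let measurable_nonneg_until_past n k : (k <= n)%N -> measurable (nonneg_until k : set (G n)).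
Proof.
have H i : (i <= n)%N -> measurable ([set w | 0 <= Z i w] : set (G n)).
  move=> ni; have := measurable_past_Z ni measurableT (measurable_itv `[0 : R, +oo[).
  rewrite setTI (_ : _ @^-1` _ = [set w | 0 <= Z i w]) //.
  by apply/seteqP; split=> w /=; rewrite in_itv /= andbT.
elim: k => [|k IH] kn.
  rewrite (_ : nonneg_until 0 = [set w | 0 <= Z 0%N w]); first exact: H.
  by apply/seteqP; split=> w /=; [apply|move=> h i; rewrite leqn0 => /eqP ->].
rewrite nonneg_untilS; apply: measurableI; first by apply: IH; exact: ltnW.
exact: H.
Qed.

Let past_sub n : <<s past n >> `<=` measurable.
Proof. by apply: smallest_sub; [exact: sigma_algebra_measurable|exact: past_measurable]. Qed.

Lemma measurable_nonneg_until n : measurable (nonneg_until n).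
Proof. apply: (@past_sub n); exact: (@measurable_nonneg_until_past n n). Qed.

(* [Y] is [Z n] killed at [-1] once the chain has been negative. *)
Lemma integral_nonneg_untilS n (h : R -> R) : measurable_fun [set: R] h -> (forall x, 0 <= h x) ->
  (\int[P]_(w in nonneg_until n.+1) (h (Z n.+1 w))%:E =
   \int[P]_(w in nonneg_until n) kernel_op a h (Z n w))%E.
Proof.
move=> mh h0.
pose Y w := if w \in nonneg_until n then Z n w else -1.
have mYG : measurable_fun [set: G n] (Y : G n -> R).
  apply: measurable_fun_if => //.
  - apply: (measurable_fun_bool true); rewrite setTI.
    rewrite (_ : _ @^-1` _ = nonneg_until n); first exact: measurable_nonneg_until_past.
    by apply/seteqP; split=> w /=; [exact: set_mem|exact: mem_set].
  - by apply: measurable_funTS; exact: measurable_past_Z.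
have YpastP (B : set R) : measurable B -> <<s past n >> (Y @^-1` B).
  by move=> mB; have := mYG measurableT B mB; rewrite setTI.
have mY : measurable_fun [set: T] Y.
  by move=> _ B mB; rewrite setTI; apply: (@past_sub n); exact: YpastP.
pose Y' : {RV P >-> R} := HB.pack Y (isMeasurableFun.Build _ _ _ _ _ mY).
have Y0 w : (0 <= Y w) = (w \in nonneg_until n).
  rewrite /Y; case: ifP => [|_]; last by rewrite ler0N1.
  by rewrite inE => hw; rewrite hw.
(* The test [0 <= y] reads survival up to time [n] off [Y], so the integrand is a function of the
   independent pair [Y], [xi n.+1]. *)
pose g (y e : R) := if 0 <= y then (if 0 <= a * y + e then h (a * y + e) else 0) else 0.
have g0 y e : 0 <= g y e by rewrite /g; case: ifP => // _; case: ifP => // _; exact: h0.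
have mg : measurable_fun [set: R * R] (fun z => (g z.1 z.2)%:E).
  apply/measurable_EFinP; rewrite /g; apply: measurable_fun_if => //.
  - by apply: measurable_fun_ler.
  - apply: measurable_funTS; apply: measurable_fun_if => //.
    + apply: measurable_fun_ler => //; apply: measurable_funD => //; exact: measurable_funM.
    + apply: measurable_funTS; apply: measurableT_comp => //.
      by apply: measurable_funD => //; exact: measurable_funM.
transitivity (\int[P]_w (g (Y' w) (xi n.+1 w))%:E)%E.
  rewrite integral_mkcond; apply: eq_integral => w _.
  have ZE : (w \in [set w | 0 <= Z n.+1 w]) = (0 <= Z n.+1 w).
    by apply/idP/idP => [/set_mem//|zw]; exact: mem_set.
  rewrite /patch nonneg_untilS in_setI ZE /= /g Y0.
  case: (boolP (w \in nonneg_until n)) => //= hw.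
  rewrite (ar1_recursion arZ) //= /Y hw.
  by case: ifP.
rewrite (@independent_fubini _ _ _ P Y' (xi n.+1) (fun z => (g z.1 z.2)%:E)) //; last 2 first.
- by move=> A B mA mB; apply: past_independent => //; exact: YpastP.
- by move=> z; rewrite lee_fin.
rewrite [RHS]integral_mkcond; apply: eq_integral => w _.
rewrite /patch /= /g Y0; case: (boolP (w \in nonneg_until n)) => hw; last first.
  by under eq_integral do []; rewrite integral0.
rewrite kernel_op_shift //.
pose k (y : R) : \bar R := (if 0 <= a * Z n w + y then h (a * Z n w + y) else 0)%:E.
have mk : measurable_fun [set: R] k.
  apply/measurable_EFinP; apply: measurable_fun_if => //.
  - apply: measurable_fun_ler => //; exact: measurable_funD.
  - by apply: measurable_funTS; apply: measurableT_comp => //; exact: measurable_funD.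
have k0 y : (0 <= k y)%E by rewrite lee_fin; case: ifP => // _; exact: h0.
have law1 : has_law (xi n.+1) (gaussian 0 1) by exact: (ar1_innovation arZ).
transitivity (\int[distribution P (xi n.+1)]_y k y)%E.
  by apply: eq_integral => y _; rewrite /k /Y hw.
rewrite (@ge0_integral_law _ _ _ P (xi n.+1) (gaussian 0 1) setT k law1 measurableT mk k0).
rewrite /gaussian sqrtr1 (ge0_integral_normal 0 1 mk k0).
by apply: eq_integral => y _; rewrite /k -EFinM mulrC.
Qed.

(** By [integral_nonneg_untilS], the expectation of [persist a k (Z m)] on survival up to [m]
    depends only on [m + k]; compare [m = n, k = 0] with [m = 0, k = n]. *)
Lemma persistence_prob n :
  (P (persistence_event (fun i => Z i : T -> R) n) =
   \int[law]_(x in [set` `[0%R, +oo[]) (persist a n x)%:E)%E.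
Proof.
have H m k : (\int[P]_(w in nonneg_until m) (persist a k (Z m w))%:E =
              \int[P]_(w in nonneg_until 0) (persist a (m + k) (Z 0%N w))%:E)%E.
  elim: m k => [|m IH] k //.
  rewrite integral_nonneg_untilS; last 2 first.
  - exact: measurable_persist.
  - by move=> x; exact: persist_ge0.
  rewrite addSnnS -IH; apply: eq_integral => w _; by rewrite -persistS.
rewrite persistence_eventE; have := H n 0%N; rewrite addn0 /= integral_cst; last first.
  exact: measurable_nonneg_until.
rewrite mul1e => ->.
have mp : measurable_fun [set: R] (fun x => (persist a n x)%:E).
  by apply/measurable_EFinP; exact: measurable_persist.
transitivity (\int[distribution P (Z 0%N)]_(x in [set` `[0%R, +oo[]) (persist a n x)%:E)%E.
  rewrite ge0_integral_pushforward //=.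
  - rewrite (_ : nonneg_until 0 = Z 0%N @^-1` `[0, +oo[) //.
    apply/seteqP; split=> w /=; rewrite in_itv /= andbT; first by apply.
    by move=> h i; rewrite leqn0 => /eqP ->.
  - exact: measurable_funTS.
  - by move=> x _; rewrite lee_fin persist_ge0.
apply: (ge0_integral_law (ar1_initial arZ)) => // x; rewrite lee_fin; exact: persist_ge0.
Qed.

End ar1_persistence.

(** * Initial laws and rates *)

Section subsequences.
Context {R : realType}.

Lemma strict_choice (Q : nat -> nat -> Prop) :
  (forall k N, exists2 n, (N <= n)%N & Q k n) ->
  exists2 f : nat -> nat, {homo f : k l / (k < l)%N} & forall k, Q k (f k).
Proof.
move=> H.
have /choice [g hg] : forall kN : nat * nat, exists n, (kN.2 <= n)%N /\ Q kN.1 n.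
  by move=> [k N]; have [n h1 h2] := H k N; exists n.
pose f := fix f k := if k is k'.+1 then g (k, (f k').+1) else g (0, 0)%N.
exists f.
  apply: homo_ltn; first exact: ltn_trans.
  by move=> k; have [] := hg (k.+1, (f k).+1).
by case=> [|k]; [have [] := hg (0, 0)%N|have [] := hg (k.+1, (f k).+1)].
Qed.

Lemma strict_cvg (f : nat -> nat) : {homo f : k l / (k < l)%N} -> f k @[k --> \oo] --> \oo.
Proof.
move=> hf; have fk k : (k <= f k)%N.
  by elim: k => [|k IH] //; exact: leq_ltn_trans IH (hf _ _ (ltnSn k)).
move=> A [N _ hN]; exists N => // k /= Nk; apply: hN => /=; exact: leq_trans Nk (fk k).
Qed.

Lemma cluster_subseq (v : nat -> R) (l : R) :
  (forall (e : R) N, 0 < e -> exists2 n, (N <= n)%N & `|v n - l| <= e) ->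
  exists2 f : nat -> nat, {homo f : k m / (k < m)%N} & v (f k) @[k --> \oo] --> l.
Proof.
move=> H.
have [f hf Q] := @strict_choice (fun k n => `|v n - l| <= k.+1%:R^-1)
  (fun k N => H _ N (ltac:(by rewrite invr_gt0) : 0 < k.+1%:R^-1 :> R)).
exists f => //; apply/cvgrPdist_le => e e0.
have : (k.+1%:R^-1 : R) @[k --> \oo] --> 0 by exact: cvg_harmonic.
move/cvgr_le => /(_ e e0); apply: filterS => k ke.
by rewrite distrC; exact: le_trans (Q k) ke.
Qed.

End subsequences.

(** * Limits of rates from bounds on both sides *)

Section rates.
Context {R : realType}.
Implicit Types (a : R) (u : nat -> R).

Lemma natr_large (K : R) : exists N : nat, forall n, (N <= n)%N -> K <= n%:R.
Proof.
exists (Num.bound `|K|) => n Kn.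
have : `|K| < (Num.bound `|K|)%:R by exact: archi_boundP.
have : (Num.bound `|K|)%:R <= n%:R :> R by rewrite ler_nat.
have := ler_norm K; lra.
Qed.

Lemma exists_truncn (y : R) : 0 <= y -> exists n : nat, n%:R <= y < n.+1%:R.
Proof.
move=> y0; have [N hN] := natr_large y.
have ex : exists n : nat, y < n%:R.
  by exists N.+1; apply: le_lt_trans (hN N (leqnn N)) _; rewrite ltr_nat.
case: (ex_minnP ex) => -[|n] yn mn; first by lra.
exists n; rewrite yn andbT leNgt; apply/negP => /mn; by rewrite ltnn.
Qed.

Lemma rate_lower a u : 0 <= a < 1 ->
  (exists2 c : R, 0 < c & forall n, c * persist a n 0 <= u n) ->
  forall e : R, 0 < e -> exists N : nat, forall n, (N <= n)%N ->
    log_theta a - e <= n%:R^-1 * ln (u n).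
Proof.
move=> /andP[a0 a1] [c c0 hc] e e0.
have e20 : 0 < e / 2 by rewrite divr_gt0.
have [C C0 hC] := persist0_lower a0 e20.
(* From [N] on, the constants cost at most [e / 2] per step; the witness [N.+1] excludes [n = 0]. *)
have [N hN] := natr_large (- (ln c + ln C) / (e / 2)).
exists N.+1 => -[//|n] Nn; have /hN := ltnW Nn; rewrite ler_pdivrMr // => h.
have n0 : 0 < n.+1%:R :> R by [].
rewrite mulrC ler_pdivlMr //.
have : ln c + (ln C + n.+1%:R * (log_theta a - e / 2)) <= ln (u n.+1).
  have p0 : 0 < c * (C * expR (n.+1%:R * (log_theta a - e / 2))) by rewrite !mulr_gt0 ?expR_gt0.
  have pu : c * (C * expR (n.+1%:R * (log_theta a - e / 2))) <= u n.+1.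
    by apply: le_trans (hc n.+1); rewrite ler_pM2l.
  have := pu; rewrite -ler_ln ?posrE ?(lt_le_trans p0 pu) //.
  by rewrite !lnM ?posrE ?mulr_gt0 ?expR_gt0 // expRK.
lra.
Qed.

Lemma rate_upper a u : 0 <= a < 1 -> (forall n, 0 < u n) ->
  (forall t : R, 0 < t < 1 -> exists C : R, forall n,
     u n <= expR (C + n%:R * ((1 - t) * log_theta a))) ->
  forall e : R, 0 < e -> exists N : nat, forall n, (N <= n)%N ->
    n%:R^-1 * ln (u n) <= log_theta a + e.
Proof.
move=> a01 u0 H e e0; have l0 := log_theta_lt0 a01; set l := log_theta a in H l0 *.
(* Small enough for [t * - l <= e / 2]; the summand [e] in the denominator keeps [t < 1]. *)
pose t := e / (2 * (1 - l) + e).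
have d0 : 0 < 2 * (1 - l) + e by lra.
have t01 : 0 < t < 1 by rewrite divr_gt0 //= ltr_pdivrMr // mul1r; lra.
have tl : t * - l <= e / 2.
  rewrite /t mulrAC ler_pdivrMr //.
  have : 0 <= e ^+ 2 by exact: sqr_ge0.
  lra.
have [C hC] := H t t01.
have [N hN] := natr_large (C / (e / 2)).
have e20 : 0 < e / 2 by rewrite divr_gt0.
exists N.+1 => -[//|n] Nn; have /hN := ltnW Nn; rewrite ler_pdivrMr // => h.
have n0 : 0 < n.+1%:R :> R by [].
rewrite mulrC ler_pdivrMr //.
have : ln (u n.+1) <= C + n.+1%:R * ((1 - t) * l).
  by rewrite -ler_expR lnK ?posrE.
have := ler_wpM2l (ltW n0) tl.
lra.
Qed.

Lemma rate_cvg a u : 0 <= a < 1 ->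
  (exists2 c : R, 0 < c & forall n, c * persist a n 0 <= u n) ->
  (forall t : R, 0 < t < 1 -> exists C : R, forall n,
     u n <= expR (C + n%:R * ((1 - t) * log_theta a))) ->
  n%:R^-1 * ln (u n) @[n --> \oo] --> log_theta a.
Proof.
move=> a01 lo up; have u0 n : 0 < u n.
  have [c c0 hc] := lo; apply: lt_le_trans (hc n).
  by rewrite mulr_gt0 // persist_gt0 //; case/andP: a01.
apply/cvgrPdist_le => e e0.
have [N1 h1] := rate_lower a01 lo e0; have [N2 h2] := rate_upper a01 u0 up e0.
exists (maxn N1 N2) => // n /=; rewrite geq_max => /andP[n1 n2].
by rewrite ler_norml; have := h1 n n1; have := h2 n n2; lra.
Qed.

End rates.

Lemma measurable_gtr (R : realType) (M : R) :
  measurable ([set x | M < x] : set (measurableTypeR R)).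
Proof.
rewrite (_ : [set x | M < x] = [set` `]M, +oo[]); first exact: measurable_itv.
by apply/seteqP; split=> x /=; rewrite in_itv /= andbT.
Qed.

(** * Survival under an arbitrary initial law *)

Section initial_law.
Context {R : realType}.
Notation mu := (@lebesgue_measure R).
Local Notation Rplus := ([set` `[0%R, +oo[] : set R).
Variables (a : R) (law : probability (measurableTypeR R) R).
Hypothesis a0 : 0 <= a.

(** Integrating over the half-line supplies the condition on the starting point that [persist]
    leaves out. *)
Definition persist_law (n : nat) : R := fine (\int[law]_(x in Rplus) (persist a n x)%:E)%E.

Lemma measurable_persist_law n (D : set (measurableTypeR R)) :
  measurable_fun D (fun x : measurableTypeR R => (persist a n x)%:E).
Proof.
have h : measurable_fun [set: R] (fun x => (persist a n x)%:E).
  by apply/measurable_EFinP; exact: measurable_persist.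
by apply: (measurable_funS measurableT) => //; exact: h.
Qed.

Let p0 n x : (0 <= (persist a n x)%:E)%E.
Proof. by rewrite lee_fin persist_ge0. Qed.

Lemma persist_lawE n : (persist_law n)%:E = (\int[law]_(x in Rplus) (persist a n x)%:E)%E.
Proof.
rewrite /persist_law fineK // ge0_fin_numE; last by apply: integral_ge0.
apply: (@le_lt_trans _ _ (\int[law]_(x in Rplus) (cst 1%:E x))%E).
  apply: ge0_le_integral => //; first exact: measurable_persist_law.
  by move=> x _; rewrite lee_fin persist_le1.
rewrite integral_cst // mul1e; apply: le_lt_trans (probability_le1 _ _) _ => //.
exact: ltry.
Qed.

Lemma persist_law_ge n (M : R) (D : set (measurableTypeR R)) : 0 <= M -> measurable D ->
  (forall x, D x -> M <= x) -> ((persist a n M)%:E * law D <= (persist_law n)%:E)%E.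
Proof.
move=> M0 mD DM; rewrite persist_lawE.
apply: (@le_trans _ _ (\int[law]_(x in D) (persist a n x)%:E)%E).
  rewrite -integral_cst //; apply: ge0_le_integral => //.
  - by move=> x _; exact: p0.
  - exact: measurable_persist_law.
  - by move=> x Dx; rewrite lee_fin persist_nd // DM.
apply: ge0_subset_integral => //; first exact: measurable_persist_law.
by move=> x Dx; rewrite /= in_itv /= andbT (le_trans M0) // DM.
Qed.

(** Starts up to [M] do no better than [M]; those beyond [M] are counted as surviving. *)
Lemma persist_law_le n (M : R) :
  ((persist_law n)%:E <= (persist a n M)%:E + law [set x | M < x]%R)%E.
Proof.
have mT := measurable_gtr M.
have mI : measurable_fun [set: measurableTypeR R]
    (fun x => ((\1_[set x | M < x] : measurableTypeR R -> R) x)%:E).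
  by apply/measurable_EFinP; exact: measurable_indic.
rewrite persist_lawE.
apply: (@le_trans _ _ (\int[law]_x ((persist a n M)%:E +
   ((\1_[set x | M < x] : measurableTypeR R -> R) x)%:E))%E); last first.
  rewrite ge0_integralD //.
  rewrite [X in (X + _ <= _)%E](_ : _ = (persist a n M)%:E); last first.
    transitivity ((persist a n M)%:E * law setT)%E; first exact: (integral_cst law measurableT).
    by rewrite (@probability_setT _ _ _ law) mule1.
  by rewrite integral_indic // setIT.
rewrite integral_mkcond; apply: ge0_le_integral => //.
- by move=> x _; rewrite /patch; case: ifP.
- by apply/(measurable_restrictT _ _).1 => //; exact: measurable_persist_law.
- by apply: emeasurable_funD.
- move=> x _; rewrite /patch -EFinD; have [Mx|xM] := ltP M x.
    rewrite [X in (_ + X)%:E](_ : _ = 1); last by rewrite indicE mem_set.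
    have h : (0 <= (persist a n M + 1)%:E)%E by rewrite lee_fin addr_ge0 // persist_ge0.
    case: ifP => _; last exact: h.
    by rewrite lee_fin; have := persist_le1 n x a0; have := persist_ge0 n M a0; lra.
  rewrite [X in (_ + X)%:E](_ : _ = 0); last first.
    by rewrite indicE memNset //=; apply/negP; rewrite -leNgt.
  rewrite addr0; case: ifP => _; last exact: p0.
  by rewrite lee_fin persist_nd.
Qed.

End initial_law.

(** * The stationary Gaussian law *)

Section gaussian_initial_law.
Context {R : realType}.
Notation mu := (@lebesgue_measure R).
Variable a : R.
Hypothesis a01 : 0 <= a < 1.

Let a0 : 0 <= a. Proof. by case/andP: a01. Qed.
Let g : R := 1 - a ^+ 2.
Let g0 : 0 < g. Proof. by rewrite subr_gt0 exprn_ilt1 //; case/andP: a01. Qed.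
Let s : R := Num.sqrt (1 / g).
Let s0 : 0 < s. Proof. by rewrite sqrtr_gt0 divr_gt0. Qed.
Let s2 : s ^+ 2 = g^-1. Proof. by rewrite sqr_sqrtr ?div1r // invr_ge0 ltW. Qed.
Let law : probability (measurableTypeR R) R := gaussian 0 (1 / g).

Let pdfE z : normal_pdf 0 s z = normal_peak s * expR (- (g * z ^+ 2 / 2)).
Proof.
rewrite normal_pdfE ?gt_eqF // /normal_fun subr0 s2; congr (_ * expR _); field.
exact: lt0r_neq0.
Qed.

(** On [[0, 1]] the stationary density is at least its value at 1, and survival is at least as
    likely as from 0. *)
Lemma gaussian_persist_lower :
  exists2 c : R, 0 < c & forall n, c * persist a n 0 <= persist_law a law n.
Proof.
exists (normal_pdf 0 s 1).
  by rewrite pdfE mulr_gt0 ?expR_gt0 // normal_peak_gt0 // gt_eqF.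
move=> n; rewrite -lee_fin mulrC EFinM.
pose D : set (measurableTypeR R) := [set` `[0, 1]].
have mD : measurable D by exact: measurable_itv.
apply: le_trans (@persist_law_ge _ _ law a0 n 0 D (lexx 0) mD _); last first.
  by move=> x; rewrite /D /= in_itv /= => /andP[].
apply: lee_wpmul2l; first by rewrite lee_fin persist_ge0.
rewrite /law /gaussian -/s /= /normal_prob.
have -> : ((normal_pdf 0 s 1)%:E = \int[mu]_(x in D) (normal_pdf 0 s 1)%:E)%E.
  have muD : mu [set` `[0, 1]] = 1%E.
    by rewrite lebesgue_measure_itv /= lte_fin ltr01 -EFinB subr0.
  transitivity ((normal_pdf 0 s 1)%:E * mu D)%E; last exact/esym/(integral_cst mu mD).
  rewrite (_ : mu D = 1%E) ?mule1 //; exact: muD.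
apply: ge0_le_integral => //.
- by move=> x _; rewrite lee_fin normal_pdf_ge0.
- by apply/measurable_EFinP; apply: measurable_funTS; exact: measurable_normal_pdf.
- move=> x; rewrite /D /= in_itv /= => /andP[x0 x1].
  rewrite lee_fin !pdfE ler_pM2l ?normal_peak_gt0 ?gt_eqF // ler_expR lerN2.
  by rewrite expr1n ler_pM2r // ler_pM2l // exprn_ile1.
Qed.

(** The stationary density is proportional to [exp (- g x^2 / 2)], so [b < g] makes the bound of
    [persist_upper] integrable; [K] is the integral of [exp (b x^2 / 2)]. *)
Lemma gaussian_persist_upper (t : R) : 0 < t < 1 ->
  exists C : R, forall n, persist_law a law n <= expR (C + n%:R * ((1 - t) * log_theta a)).
Proof.
move=> t01; have [C [b [/andP[b0 bg] H]]] := persist_upper a01 t01.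
have k0 : 0 < g - b by rewrite subr_gt0.
pose K := normal_peak s / normal_peak 1 * Num.sqrt (g - b)^-1.
have ps0 : 0 < normal_peak s by rewrite normal_peak_gt0 ?gt_eqF.
have p1 := @normal_peak1_gt0 R.
have K0 : 0 < K by rewrite mulr_gt0 ?divr_gt0 // sqrtr_gt0 invr_gt0.
pose V (x : R) : \bar R := (expR (b * x ^+ 2 / 2))%:E.
have mV : measurable_fun [set: R] V by apply/measurable_EFinP; exact: measurable_expR_sqr.
have V0 x : (0 <= V x)%E by rewrite lee_fin expR_ge0.
have VK : (\int[normal_prob 0 s]_x V x = K%:E)%E.
  rewrite (ge0_integral_normal 0 s mV V0) /K EFinM -(gauss_integral 0 k0) -ge0_integralZl_EFin //.
  - apply: eq_integral => x _; rewrite pdfE /V -!EFinM; congr EFin.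
    rewrite subr0 mulrCA mulrA [RHS]mulrA divfK ?gt_eqF // -mulrA -expRD; congr (_ * expR _).
    by field.
  - by move=> x _; rewrite lee_fin mulr_ge0 ?expR_ge0 // ltW.
  - exact: measurable_gauss.
  - by rewrite divr_ge0 // ltW.
exists (C + ln K) => n; set E := expR (C + n%:R * ((1 - t) * log_theta a)).
have -> : expR (C + ln K + n%:R * ((1 - t) * log_theta a)) = E * K.
  have KE : K = expR (ln K) by rewrite lnK ?posrE.
  by rewrite [in RHS]KE /E -expRD; congr expR; ring.
rewrite -lee_fin persist_lawE // EFinM -VK.
rewrite -(ge0_integralZl_EFin (normal_prob 0 s) measurableT (fun x _ => V0 x) mV (expR_ge0 _)).
pose F (x : measurableTypeR R) : \bar R := (E%:E * V x)%E.
have mF : measurable_fun [set: measurableTypeR R] F by exact: (measurable_funeM E%:E mV).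
have F0 x : (0 <= F x)%E by rewrite mule_ge0 // lee_fin expR_ge0.
have mI : measurable ([set` `[0%R, +oo[] : set (measurableTypeR R)) by exact: measurable_itv.
have h : (\int[law]_(x in [set` `[0%R, +oo[]) (persist a n x)%:E <= \int[law]_x F x)%E.
  apply: (@le_trans _ _ (\int[law]_(x in [set` `[0%R, +oo[]) F x)%E).
    apply: ge0_le_integral => //.
    - by move=> x _; rewrite lee_fin persist_ge0.
    - exact: measurable_persist_law.
    - exact: measurable_funTS.
    - move=> x; rewrite /= in_itv /= andbT => x0.
      by rewrite /F /V -EFinM lee_fin /E -expRD H.
  exact: ge0_subset_integral.
exact: h.
Qed.

End gaussian_initial_law.

(** * Initial laws with oscillating tails *)

Section tails.
Context {R : realType} (law : probability (measurableTypeR R) R).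
Notation tail M := (law [set x | M < x]).

Let tail_cases (M : R) : exists2 q : R, 0 <= q & tail M = q%:E.
Proof.
have mT := measurable_gtr M.
exists (fine (tail M)); first by apply: fine_ge0; exact: measure_ge0.
by rewrite fineK // fin_num_measure.
Qed.

Let large_nbhs (M0 : R) : pinfty_nbhs R [set M | Num.max M0 1 < M].
Proof. by exists (Num.max M0 1); split; first exact: num_real. Qed.

(** Beyond any level the supremum of the ratio is at least its upper limit 0, so the ratio exceeds
    [- e] somewhere. With [M > 1] the logarithm is positive, and this reads as a tail of at least
    [M^-e]. *)
Lemma heavy_tail (e M0 : R) : limf_esup (log_tail_ratio law) (pinfty_nbhs R) = 0%E -> 0 < e ->
  exists2 M, Num.max M0 1 < M & ((expR (- e * ln M))%:E <= tail M)%E.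
Proof.
move=> sup0 e0.
pose V := [set M | Num.max M0 1 < M].
have h : (0 <= ereal_sup (log_tail_ratio law @` V))%E.
  by rewrite -sup0; apply: ereal_inf_lbound; exists V => //; exact: large_nbhs.
have : ((- e)%:E < ereal_sup (log_tail_ratio law @` V))%E.
  by apply: lt_le_trans h; rewrite lte_fin oppr_lt0.
move=> /ereal_sup_gt [_ [M hM <-] eM]; exists M => //.
have M1 : 1 < M by apply: le_lt_trans hM; rewrite le_max lexx orbT.
have lM : 0 < ln M by rewrite ln_gt0.
move: eM; rewrite /log_tail_ratio; have [q q0 ->] := tail_cases M.
(* A vanishing tail would have ratio [-oo]. *)
have [q1|q1] := leP q 0.
  by rewrite le0_lneNy ?lee_fin // gt0_muleNy ?lte_fin ?invr_gt0 // ltNge leNye.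
rewrite lne_EFin // -EFinM !lte_fin lee_fin mulrC ltr_pdivlMr // => eM.
by rewrite -[leRHS]lnK ?posrE // ler_expR ltW.
Qed.

Lemma light_tail (K M0 : R) : limf_einf (log_tail_ratio law) (pinfty_nbhs R) = -oo%E ->
  exists2 M, Num.max M0 1 < M & (tail M <= (expR (- K * ln M))%:E)%E.
Proof.
rewrite limf_einfE => inf0.
pose V := [set M | Num.max M0 1 < M].
have : (ereal_inf (log_tail_ratio law @` V) < (- K)%:E)%E.
  apply: (@le_lt_trans _ _ -oo%E); last exact: ltNyr.
  rewrite -inf0; apply: ereal_sup_ubound.
  by exists V => //; exact: large_nbhs.
move=> /ereal_inf_lt [_ [M hM <-] eM]; exists M => //.
have M1 : 1 < M by apply: le_lt_trans hM; rewrite le_max lexx orbT.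
have lM : 0 < ln M by rewrite ln_gt0.
move: eM; rewrite /log_tail_ratio; have [q q0 ->] := tail_cases M.
(* Here a vanishing tail meets the bound outright. *)
have [q1 _|q1] := leP q 0.
  by rewrite lee_fin (le_trans q1) // expR_ge0.
rewrite lne_EFin // -EFinM !lte_fin lee_fin mulrC ltr_pdivrMr // => eM.
by rewrite -[leLHS]lnK ?posrE // ler_expR ltW.
Qed.

Variable a : R.
Hypothesis a01 : 0 < a < 1.
Hypothesis heavy : limf_esup (log_tail_ratio law) (pinfty_nbhs R) = 0%E.
Hypothesis light : limf_einf (log_tail_ratio law) (pinfty_nbhs R) = -oo%E.

Let a0 : 0 <= a. Proof. by case/andP: a01 => /ltW. Qed.
Let u := persist_law a law.
Let lam := - ln a.
Let lam0 : 0 < lam. Proof. by rewrite oppr_gt0 ln_lt0. Qed.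

Let powE k : a ^- k = expR (k%:R * lam).
Proof. by rewrite expR_lnX; [rewrite -expRN /lam mulrN|case/andP: a01]. Qed.

Let u_tail n (M : R) : 0 <= M -> forall q : R, 0 <= q -> (q%:E <= tail M)%E ->
  persist a n M * q <= u n.
Proof.
move=> M0 q q0 hq; rewrite -lee_fin EFinM.
have mT := measurable_gtr M.
apply: le_trans (persist_law_ge law a0 n M0 mT (fun x => @ltW _ _ M x)).
by apply: lee_wpmul2l => //; rewrite lee_fin persist_ge0.
Qed.

(** Some level [M >= 0] has positive mass above it, from where survival is at least as likely as
    from 0. *)
Lemma tail_persist_lower : exists2 c : R, 0 < c & forall n, c * persist a n 0 <= u n.
Proof.
have [M hM hT] := heavy_tail 0 heavy ltr01.
have M0 : 0 <= M by apply: ltW; apply: le_lt_trans hM; rewrite le_max lexx.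
exists (expR (- 1 * ln M)); first exact: expR_gt0.
move=> n; apply: le_trans (u_tail n M0 (expR_ge0 _) hT).
by rewrite mulrC ler_wpM2r ?expR_ge0 // persist_nd.
Qed.

Lemma u_le1 n : u n <= 1.
Proof.
rewrite -lee_fin persist_lawE //.
apply: (@le_trans _ _ (\int[law]_(x in [set` `[0%R, +oo[]) (cst 1%:E x))%E).
  apply: ge0_le_integral => //.
  - by move=> x _; rewrite lee_fin persist_ge0.
  - exact: measurable_persist_law.
  - by move=> x _; rewrite lee_fin persist_le1.
by rewrite integral_cst // mul1e probability_le1.
Qed.

(** At a level [M] with tail at least [M^-e'], take [n] of order [ln M / lam]: starting above [M],
    survival costs [e / 2] per step by [persist_far], and the tail costs [e' ln M], at most
    [e (1 + n) / 4]. *)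
Lemma slow_times (e : R) N : 0 < e ->
  exists2 n, (N <= n)%N & `|n%:R^-1 * ln (u n) - 0| <= e.
Proof.
move=> e0; have /andP[ap a1] := a01.
(* Solves [1 - expR (1 / 2 - r) = expR (- (e / 2))]. *)
pose r := 1 / 2 - ln (1 - expR (- (e / 2))).
have q0 : 0 < 1 - expR (- (e / 2)) < 1.
  by rewrite subr_gt0 expR_lt1 oppr_lt0 divr_gt0 //= gtrBl expR_gt0.
have r0 : 0 < r by have := ln_lt0 q0; rewrite /r; lra.
have qE : 1 - expR (1 / 2 - r) = expR (- (e / 2)).
  have -> : 1 / 2 - r = ln (1 - expR (- (e / 2))) by rewrite /r; ring.
  by rewrite lnK ?posrE; [ring|case/andP: q0].
pose c := r / (1 - a); have c0 : 0 < c by rewrite divr_gt0 // subr_gt0.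
pose L := `|ln c| + lam.
have L0 : 0 < L by rewrite ltr_wpDl.
pose e' := e / (4 * L); have e'0 : 0 < e' by rewrite divr_gt0 // mulr_gt0.
have [M hM hT] := heavy_tail (c * expR (N.+2%:R * lam)) heavy e'0.
have M1 : 1 < M by apply: le_lt_trans hM; rewrite le_max lexx orbT.
have MN : c * expR (N.+2%:R * lam) < M by apply: le_lt_trans hM; rewrite le_max lexx.
have Mc0 : 0 < M / c by rewrite divr_gt0 // (lt_trans _ M1).
(* The real solution of [c (a^-y - 1) = M]; [n] is its integer part. *)
pose y := ln (M / c + 1) / lam.
have yN : N.+2%:R <= y.
  rewrite ler_pdivlMr // -ler_expR lnK ?posrE ?addr_gt0 //.
  by rewrite ler_wpDr // ler_pdivlMr // mulrC ltW.
have [n /andP[ny yn]] := exists_truncn (le_trans (ler0n R N.+2) yN).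
have nN : (N < n)%N.
  by have := le_lt_trans yN yn; rewrite ltr_nat ltnS => h; exact: ltnW.
exists n; first exact: ltnW.
have n0 : 0 < n%:R :> R by rewrite ltr0n (leq_trans _ nN).
have n1 : 1 <= n%:R :> R by rewrite ler1n (leq_trans _ nN).
have h1 : c * (a ^- n - 1) <= M.
  rewrite -ler_pdivlMl // mulrC lerBlDr powE -[leRHS]lnK ?posrE ?addr_gt0 // ler_expR.
  by rewrite -ler_pdivlMr.
have q1 : 0 <= 1 - expR (1 / 2 - r) by rewrite qE expR_ge0.
have h2 := persist_far a01 (ltW r0) q1 h1.
have lMn : ln M <= L * (1 + n%:R).
  have : ln (M / c) <= ln (M / c + 1) by rewrite ler_ln ?posrE ?addr_gt0 // lerDl.
  have : ln (M / c + 1) <= n.+1%:R * lam by rewrite -ler_pdivrMr // ltW.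
  rewrite ln_div ?posrE ?(lt_trans _ M1) // -natr1.
  have := ler_norm (ln c); have : 0 <= n%:R * `|ln c| by rewrite mulr_ge0.
  by rewrite /L; lra.
have M0 : 0 <= M by rewrite ltW // (lt_trans _ M1).
have hu := u_tail n M0 (expR_ge0 _) hT.
have low : expR (n%:R * - (e / 2)) * expR (- e' * ln M) <= u n.
  apply: le_trans hu; rewrite ler_wpM2r ?expR_ge0 // expRM_natl -qE; exact: h2.
have u0 : 0 < u n by apply: lt_le_trans low; rewrite mulr_gt0 ?expR_gt0.
have lu : ln (u n) <= 0 by rewrite ln_le0 // u_le1.
have low' : - (n%:R * (e / 2)) - e' * ln M <= ln (u n).
  by have := low; rewrite -expRD -[leRHS]lnK ?posrE // ler_expR; lra.
have e'L : e' * ln M <= e / 4 * (1 + n%:R).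
  have -> : e / 4 * (1 + n%:R) = e' * (L * (1 + n%:R)).
    by rewrite /e'; field; rewrite gt_eqF.
  by rewrite ler_wpM2l // ltW.
rewrite subr0 ler0_norm; last by rewrite pmulr_rle0 ?invr_gt0.
rewrite -mulrN mulrC ler_pdivrMr //.
have : e / 4 <= e / 4 * n%:R by rewrite ler_peMr // divr_ge0 // ltW.
lra.
Qed.

(** At a level [M <= a^-k] with tail at most [M^-K], run [n = (r + 1) k] steps: starts below [M]
    delay the decay by [k] steps only, a small part of [n], and starts above have mass at most
    [theta^n]. *)
Lemma fast_times (e : R) N : 0 < e ->
  exists2 n, (N <= n)%N & `|n%:R^-1 * ln (u n) - log_theta a| <= e.
Proof.
move=> e0; have /andP[ap a1] := a01; have a01' : 0 <= a < 1 by rewrite a0.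
have l0 := log_theta_lt0 a01'; set l := log_theta a in l0 *.
have [c c0 hc] := tail_persist_lower.
have u0 n : 0 < u n by apply: lt_le_trans (hc n); rewrite mulr_gt0 // persist_gt0.
have [N1 hN1] := rate_lower a01' (ex_intro2 _ _ c c0 hc) e0; rewrite -/l in hN1.
pose t := e / (4 * (1 - l) + e).
have d0 : 0 < 4 * (1 - l) + e by lra.
have t01 : 0 < t < 1 by rewrite divr_gt0 //= ltr_pdivrMr // mul1r; lra.
have tl : t * - l <= e / 4.
  rewrite /t mulrAC ler_pdivrMr //; have : 0 <= e ^+ 2 by exact: sqr_ge0.
  lra.
have [C [B [B0 hCB]]] := persist_upper_far a01 t01; rewrite -/l in hCB.
(* [r] makes the cost [k (B - l)] of the delay at most [n e / 4]. *)
have [r hr] := natr_large ((B - l) / (e / 4)).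
have {}hr : B - l <= r.+1%:R * (e / 4) by rewrite -ler_pdivrMr ?divr_gt0 // hr.
have ln20 : 0 <= ln 2 :> R by rewrite ln_ge0 // ler1n.
have [N2 hN2] := natr_large ((`|C| + ln 2) / (e / 2)).
pose N3 := maxn 2 (maxn N (maxn N1 N2)).
(* Gives [M^-K <= theta^n], using [k <= 2 k0] (as [k0 >= 2]) and [k0 lam <= ln M]. *)
pose K := 2 * r.+1%:R * - l / lam.
have [M hM hT] := light_tail K (expR (N3%:R * lam)) light.
have M1 : 1 < M by apply: le_lt_trans hM; rewrite le_max lexx orbT.
have MN : expR (N3%:R * lam) < M by apply: le_lt_trans hM; rewrite le_max lexx.
have M0 : 0 < M by rewrite (lt_trans _ M1).
have lM : N3%:R <= ln M / lam by rewrite ler_pdivlMr // -ler_expR lnK ?posrE // ltW.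
have [k0 /andP[k0M Mk0]] := exists_truncn (le_trans (ler0n R N3) lM).
have N3k : (N3 <= k0)%N by have := le_lt_trans lM Mk0; rewrite ltr_nat ltnS.
(* Rounding [ln M / lam] up gives [M <= a^-k], as [persist_upper_far] requires. *)
pose k := k0.+1; pose n := (r * k + k)%N.
have kn : (k <= n)%N by rewrite leq_addl.
have N3n : (N3 <= n)%N by rewrite (leq_trans N3k) // (leq_trans _ kn).
have := N3n; rewrite !geq_max => /and4P[_ Nn N1n N2n].
have nE : n%:R = r.+1%:R * k%:R :> R by rewrite /n -mulSnr natrM.
have n0 : 0 < n%:R :> R by rewrite ltr0n (leq_trans _ kn).
exists n => //.
have hU : u n <= expR (C + k%:R * B + (r * k)%:R * ((1 - t) * l)) + expR (- K * ln M).
  rewrite -lee_fin EFinD; apply: le_trans (persist_law_le law a0 n M) _.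
  apply: leeD => //; rewrite lee_fin; apply: hCB; rewrite (ltW M0) /= powE.
  by rewrite -[leLHS]lnK ?posrE // ler_expR -ler_pdivrMr // ltW.
have hK : - K * ln M <= n%:R * l.
  have k2 : k%:R <= 2 * k0%:R :> R.
    rewrite -natrM ler_nat /k mul2n -addnn -addn1 leq_add2l.
    by apply: leq_trans N3k; rewrite /N3 leq_max.
  have k0l : k0%:R * lam <= ln M by rewrite -ler_pdivlMr.
  have q0 : 0 <= r.+1%:R * - l by rewrite mulr_ge0 // oppr_ge0 ltW.
  have : r.+1%:R * - l * k%:R <= r.+1%:R * - l * (2 * k0%:R) by rewrite ler_wpM2l.
  have : 2 * (r.+1%:R * - l) / lam * (k0%:R * lam) <= 2 * (r.+1%:R * - l) / lam * ln M.
    by rewrite ler_wpM2l // divr_ge0 ?(ltW lam0) // mulr_ge0.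
  have -> : 2 * (r.+1%:R * - l) / lam * (k0%:R * lam) = r.+1%:R * - l * (2 * k0%:R).
    by field; rewrite gt_eqF.
  have -> : 2 * (r.+1%:R * - l) / lam = K by rewrite /K; ring.
  rewrite nE mulNr; lra.
have hC : C + k%:R * B + (r * k)%:R * ((1 - t) * l) <= n%:R * l + `|C| + n%:R * (e / 2).
  have E : (r * k)%:R = n%:R - k%:R :> R by rewrite /n natrD addrK.
  rewrite E; have := ler_norm C.
  have kk : 0 <= k%:R :> R by [].
  have := ler_wpM2l kk hr.
  have -> : k%:R * (r.+1%:R * (e / 4)) = n%:R * (e / 4) by rewrite nE; ring.
  have := ler_wpM2l (ltW n0) tl.
  have : k%:R * t * l <= 0.
    by rewrite -mulrA mulr_ge0_le0 // mulr_ge0_le0 ?(ltW l0) //; case/andP: t01 => /ltW.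
  lra.
have hE : n%:R * l <= n%:R * l + `|C| + n%:R * (e / 2).
  by rewrite -addrA lerDl addr_ge0 // mulr_ge0 // divr_ge0 // ltW.
(* Both terms of [hU] are below the same exponential, whence [ln 2]. *)
have up : ln (u n) <= ln 2 + (n%:R * l + `|C| + n%:R * (e / 2)).
  rewrite -ler_expR lnK ?posrE // expRD lnK ?posrE //; apply: le_trans hU _.
  rewrite [leRHS]mulr_natl mulr2n; apply: lerD; rewrite ler_expR //; exact: le_trans hK hE.
have := hN2 _ N2n; rewrite ler_pdivrMr ?divr_gt0 // => hn2.
rewrite ler_norml; apply/andP; split; first by have := hN1 n N1n; lra.
rewrite lerBlDr mulrC ler_pdivrMr //; lra.
Qed.

End tails.

(** * Continuity of the exponent *)

Section theta_continuity.
Context {R : realType}.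

Lemma log_theta_continuous : {within `[0, 1[, continuous (@log_theta R)}.
Proof.
apply/subspace_continuousP => x; rewrite /= in_itv /= => /andP[x0 x1].
(* The Lipschitz bound needs parameters away from 1; the midpoint of [x] and 1 leaves a
   neighbourhood of [x]. *)
have A01 : 0 <= (1 + x) / 2 < 1 by apply/andP; split; lra.
have [d [L [d0 L0 H]]] := log_theta_lipschitz A01.
apply/cvgrPdist_le => e e0; rewrite near_withinE.
pose r := Num.min d (Num.min (e / (L + 1)) ((1 - x) / 2)).
have L1 : 0 < L + 1 by lra.
have r0 : 0 < r by rewrite !lt_min d0 !divr_gt0 // subr_gt0.
near=> y; rewrite /= in_itv /= => /andP[y0 y1].
have : `|x - y| < r by near: y; exact: nbhsx_ballx.
rewrite !lt_min => /and3P[xyd xye xy1].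
have yA : y <= (1 + x) / 2 by move: xy1; rewrite ltr_norml => /andP[]; lra.
have xA : x <= (1 + x) / 2 by lra.
have h1 := H x y; rewrite x0 xA y0 yA distrC in h1.
have h2 := H y x; rewrite x0 xA y0 yA in h2.
have b : `|x - y| * L <= e.
  apply: (@le_trans _ _ (e / (L + 1) * (L + 1))); last by rewrite divfK ?gt_eqF.
  by apply: ler_pM; [exact: normr_ge0|exact: L0|exact: ltW|rewrite lerDl].
change (`|log_theta x - log_theta y| <= e).
have h3 := le_trans (h1 isT isT (ltW xyd)) b; have h4 := le_trans (h2 isT isT (ltW xyd)) b.
move: (log_theta x) (log_theta y) h3 h4 => p q h3 h4.
by rewrite ler_norml lerNl opprB h3 h4.
Unshelve. all: by end_near.
Qed.

End theta_continuity.

(** * From rates of the kernel to rates of the process *)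

Section process_rate.
Context {R : realType} (d : measure_display) (T : measurableType d) (P : probability T R).
Variables (a : R) (law : probability (measurableTypeR R) R) (Z xi : nat -> {RV P >-> R}).
Hypothesis a01 : 0 <= a < 1.
Hypothesis arZ : ar1_process a (gaussian 0 1) law Z xi.
Hypothesis lower : exists2 c : R, 0 < c & forall n, c * persist a n 0 <= persist_law a law n.

(** The lower bound makes the probability positive, so the extended logarithm is finite. *)
Lemma persistence_rateE n :
  persistence_rate Z n = (n%:R^-1 * ln (persist_law a law n))%:E.
Proof.
have a0 : 0 <= a by case/andP: a01.
have u0 : 0 < persist_law a law n.
  by have [c c0 hc] := lower; apply: lt_le_trans (hc n); rewrite mulr_gt0 // persist_gt0.
by rewrite /persistence_rate (persistence_prob a0 arZ) -persist_lawE // lne_EFin // -EFinM.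
Qed.

Lemma persistence_rate_cvg :
  (forall t : R, 0 < t < 1 -> exists C : R, forall n,
     persist_law a law n <= expR (C + n%:R * ((1 - t) * log_theta a))) ->
  persistence_rate Z n @[n --> \oo] --> lne (expR (log_theta a))%:E.
Proof.
move=> up; rewrite lne_EFin ?expR_gt0 // expRK.
rewrite (_ : persistence_rate Z = EFin \o (fun n => n%:R^-1 * ln (persist_law a law n))); last first.
  by apply/funext => n; exact: persistence_rateE.
apply/fine_cvgP; split; first exact: nearW.
exact: rate_cvg.
Qed.

End process_rate.

(** * Existence and continuity of the exponent, and the effect of the initial law *)

Theorem proposition2p5 (R : realType) :
  exists theta : R -> R,
  (* (a) *)
  [/\ (forall a : R, 0 <= a < 1 ->
         has_persistence_exponent a (gaussian 0 (1 / (1 - a ^+ 2))) (theta a)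
         /\ 0 < theta a < 1),
      {within `[0, 1[, continuous theta},
  (* (b) *)
      (forall (a : R) (mu : probability (measurableTypeR R) R), 0 < a < 1 ->
         limf_esup (log_tail_ratio mu) (pinfty_nbhs R) = 0%E ->
         limf_einf (log_tail_ratio mu) (pinfty_nbhs R) = -oo%E ->
         forall (d : measure_display) (T : measurableType d)
           (P : probability T R) (Z xi : nat -> {RV P >-> R}),
         ar1_process a (gaussian 0 1) mu Z xi ->
         (exists m n : nat -> nat,
            [/\ {homo m : k l / (k < l)%N}, {homo n : k l / (k < l)%N},
                persistence_rate Z (m k) @[k --> \oo] --> 0%E &
                persistence_rate Z (n k) @[k --> \oo] --> lne (theta a)%:E])
         /\ ~ cvg (persistence_rate Z n @[n --> \oo])) &
  (* (c) *)
      (forall a x0 : R, 0 <= a < 1 -> 0 < x0 ->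
         has_persistence_exponent a (dirac_law x0) (theta a))].
Proof.
exists (fun a => expR (log_theta a)); split.
- move=> a a01; split; last by rewrite expR_gt0 expR_lt1 log_theta_lt0.
  move=> d T P Z xi arZ; apply: (persistence_rate_cvg a01 arZ).
    exact: gaussian_persist_lower.
  by move=> t; exact: gaussian_persist_upper.
- apply/subspace_continuousP => x x01.
  have /subspace_continuousP/(_ x x01) h := @log_theta_continuous R.
  by apply: continuous_cvg => //; exact: continuous_expR.
- move=> a law a01 heavy light d T P Z xi arZ.
  have a01' : 0 <= a < 1 by case/andP: a01 => /ltW -> ->.
  have lower := tail_persist_lower a01 heavy.
  have E := persistence_rateE a01' arZ lower.
  pose v n := n%:R^-1 * ln (persist_law a law n).
  have [m hm cm] : exists2 f : nat -> nat, {homo f : k l / (k < l)%N} & v (f k) @[k --> \oo] --> 0.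
    by apply: cluster_subseq => e N; exact: slow_times.
  have [n hn cn] : exists2 f : nat -> nat, {homo f : k l / (k < l)%N} &
      v (f k) @[k --> \oo] --> log_theta a.
    by apply: cluster_subseq => e N; exact: fast_times.
  have sub (f : nat -> nat) l : v (f k) @[k --> \oo] --> l ->
      persistence_rate Z (f k) @[k --> \oo] --> l%:E.
    move=> h; rewrite (_ : (fun k => _) = EFin \o (fun k => v (f k))); last first.
      by apply/funext => k; rewrite E.
    by apply/fine_cvgP; split; first exact: nearW.
  split.
    exists m, n; split => //; first exact: sub.
    by rewrite lne_EFin ?expR_gt0 // expRK; exact: sub.
  (* A limit would be shared by both subsequences, forcing [log_theta a = 0]. *)
  move=> c.
  have h1 := cvg_unique (@ereal_hausdorff R) (cvg_comp _ _ (strict_cvg hm) c) (sub _ _ cm).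
  have h2 := cvg_unique (@ereal_hausdorff R) (cvg_comp _ _ (strict_cvg hn) c) (sub _ _ cn).
  have := log_theta_lt0 a01'; have PF (f : nat -> nat) : ProperFilter ((persistence_rate Z \o f) x @[x --> \oo]).
    exact: fmap_proper_filter.
  by have := h2 (PF n); rewrite (h1 (PF m)) => -[<-]; rewrite ltxx.
- move=> a x0 a01 x00 d T P Z xi arZ.
  have a0 : 0 <= a by case/andP: a01.
  (* The mass sits inside the half-line because [x0 > 0]. *)
  have uE n : persist_law a (dirac_law x0) n = persist a n x0.
    apply: EFin_inj; rewrite persist_lawE // /dirac_law integral_dirac //.
    + by rewrite diracE mem_set ?mul1e //= in_itv /= andbT ltW.
    + exact: measurable_persist_law.
  apply: (persistence_rate_cvg a01 arZ).
    by exists 1 => // n; rewrite mul1r uE persist_nd // ltW.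
  move=> t t01; have [C [b [_ H]]] := persist_upper a01 t01.
  exists (C + b * x0 ^+ 2 / 2) => n; rewrite uE; apply: le_trans (H n x0 (ltW x00)) _.
  by rewrite ler_expR; lra.
Qed.
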